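(* Let $\mathfrak{g}$ be a real semisimple Lie algebra, $R:\mathfrak{g}\to\mathfrak{g}$ a skew-symmetric non-split solution of the modified classical Yang-Baxter equation ($c=i$), and $\gamma\in\mathbb{R}\setminus\{0\}$. Let $g(\sigma)\in G$ and $X(\sigma)\in\mathfrak{g}$, $\sigma\in\mathbb{R}$, be fields with Poisson brackets $$\{g_1(\sigma),g_2(\sigma')\}=0,\quad \{X_1(\sigma),g_2(\sigma')\}=g_2(\sigma)C_{12}\,\delta_{\sigma\sigma'},\quad \{X_1(\sigma),X_2(\sigma')\}=-[C_{12},X_2(\sigma)]\,\delta_{\sigma\sigma'},$$ with $X(\sigma)\to0$ as $\sigma\to\pm\infty$. Put $T^g(\lambda_\pm;\sigma,\sigma')=\mathrm{P}\overleftarrow{\exp}\big(-\int_{\sigma'}^{\sigma}d\rho\,\gamma R^\pm X(\rho)\big)$ and $T^g(\lambda_\pm)=T^g(\lambda_\pm;+\infty,-\infty)$. For $\epsilon\in\mathfrak{g}$ and any observable $f$ define $$\delta_\epsilon f=-\frac{1}{2i\gamma}\,\kappa\Big(\epsilon,\;T^g(\lambda_+)^{-1}\{T^g(\lambda_+),f\}-T^g(\lambda_-)^{-1}\{T^g(\lambda_-),f\}\Big).$$ Then $$\delta_\epsilon g(\sigma)=g(\sigma)K(\sigma),\qquad \delta_\epsilon X(\sigma)=[X(\sigma),K(\sigma)],$$ where $$K(\sigma)=\frac{1}{2i}R^+\Big(T^g(\lambda_-;\sigma,-\infty)\,\epsilon\,T^g(\lambda_-;\sigma,-\infty)^{-1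}\Big)-\frac{1}{2i}R^-\Big(T^g(\lambda_+;\sigma,-\infty)\,\epsilon\,T^g(\lambda_+;\sigma,-\infty)^{-1}\Big).$$
   Context: The modified classical Yang-Baxter equation with $c=i$ is $[RX,RY]-R([RX,Y]+[X,RY])=[X,Y]$ for all $X,Y\in\mathfrak{g}$; skew-symmetry is with respect to the Killing form $\kappa$. $R^\pm=R\pm i\,\mathrm{Id}$, extended $\mathbb{C}$-linearly to the complexification $\mathfrak{g}^{\mathbb{C}}$; $\kappa$ is also extended $\mathbb{C}$-bilinearly. $C_{12}$ is the quadratic Casimir, i.e. $\kappa_2(C_{12},Y_2)=Y$. $G$ is a Lie group with Lie algebra $\mathfrak{g}$, $G^{\mathbb{C}}$ its complexification; subscripts $1,2$ are tensor-factor indices in matrix notation, $\delta_{\sigma\sigma'}$ is the Dirac distribution. The path-ordered exponential $T(\sigma,\sigma')=\mathrm{P}\overleftarrow{\exp}(-\int_{\sigma'}^{\sigma}d\rho\,\mathcal{L}(\rho))$ is the solution of $(\partial_\sigma T(\sigma,\sigma'))T(\sigma,\sigma')^{-1}=-\mathcal{L}(\sigma)$, $T(\sigma',\sigma')=1$, and Poisson brackets of $T$ with observables are computed from the variation formula $\delta T(\sigma,\sigma')=-\int_{\sigma'}^{\sigma}d\rho\,T(\sigma,\rho)\,\delta\mathcal{L}(\rho)\,T(\rho,\sigma')$. $X$ is assumed to decay fast enough for all integrals to converge. *)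

(* Defs.v *)
From HB Require Import structures.
From mathcomp Require Export all_boot all_order all_algebra.
From mathcomp.real_closed Require Export complex mxtens.
From mathcomp Require Export all_classical all_reals all_analysis.
Export Order.TTheory GRing.Theory Num.Theory.
Export numFieldNormedType.Exports.

Set Implicit Arguments.
Unset Strict Implicit.
Unset Printing Implicit Defensive.

Global Open Scope classical_set_scope.
Global Open Scope ring_scope.

Definition lie (F : pzRingType) (N : nat) (A B : 'M[F]_N) : 'M[F]_N :=
  A *m B - B *m A.

(** * Real matrix Lie algebras *)

Section LieAlgebra.
Variables (R : realType) (N : nat).
Implicit Types (L I U V : {vspace 'M[R]_N}) (A B : 'M[R]_N).

Definition lie_subalgebra L : Prop :=
  forall A B, A \in L -> B \in L -> lie A B \in L.

Definition lie_ideal L I : Prop :=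
  (I <= L)%VS /\ forall A B, A \in L -> B \in I -> lie A B \in I.

Definition lie_prodv U V : {vspace 'M[R]_N} :=
  <<[seq lie A B | A <- vbasis U, B <- vbasis V]>>%VS.

Definition lie_solvable I : Prop :=
  exists k : nat, iter k (fun U => lie_prodv U U) I = 0%VS.

Definition lie_semisimple L : Prop :=
  forall I, lie_ideal L I -> lie_solvable I -> I = 0%VS.

(* Trace of ad A \o ad B on L, computed in a basis of L.  Only meaningful for
   A, B in L. *)
Definition killing L A B : R :=
  \sum_(i < \dim L) coord (vbasis L) i (lie A (lie B (vbasis L)`_i)).

(* An endomorphism of L is given by an endomorphism of the matrix space that
   preserves L; only its values on L matter. *)
Definition endo_on L (r : 'End('M[R]_N)) : Prop := (r @: L <= L)%VS.

Definition killing_skew L (r : 'End('M[R]_N)) : Prop :=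
  forall A B, A \in L -> B \in L -> killing L (r A) B = - killing L A (r B).

(* The modified classical Yang-Baxter equation for c = i. *)
Definition mCYBE_nonsplit L (r : 'End('M[R]_N)) : Prop :=
  forall A B, A \in L -> B \in L ->
    lie (r A) (r B) - r (lie (r A) B + lie A (r B)) = lie A B.

(* C = \sum_k a_k (x) b_k lies in L (x) L and kappa_2(C_12, Y_2) = Y. *)
Definition casimir_decomposition L (n : nat) (a b : 'I_n -> 'M[R]_N) : Prop :=
  [/\ forall k, a k \in L, forall k, b k \in L &
      forall A, A \in L -> \sum_k killing L (b k) A *: a k = A].

(* The Kronecker product *t implements the tensor-factor notation:
   A_1 = A *t 1 and A_2 = 1 *t A. *)
Definition casimir (n : nat) (a b : 'I_n -> 'M[R]_N) : 'M[R]_(N * N) :=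
  \sum_k a k *t b k.

Definition is_mxderive (m n : nat) (F : R -> 'M[R]_(m, n)) (s : R)
    (D : 'M[R]_(m, n)) : Prop :=
  forall i j, is_derive s (1 : R) (fun t => F t i j) (D i j).

(* G is a subgroup of GL_N(R) whose Lie algebra is L: A lies in L exactly when
   the solution t |-> exp(tA) of c' = A c, c(0) = 1 stays in G.  Closedness is
   not required, so immersed Lie subgroups are included. *)
Definition matrix_group_with_lie_algebra (G : set 'M[R]_N) L : Prop :=
  [/\ G 1%:M, forall g, G g -> g \in unitmx,
      forall g h, G g -> G h -> G (g *m h),
      forall g, G g -> G (invmx g) &
      forall A, A \in L <->
        exists c : R -> 'M[R]_N,
          [/\ c 0 = 1%:M, forall t, is_mxderive c t (A *m c t) &
              forall t, G (c t)]].

Definition mx_integral (m n : nat)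
    (mu : {measure set (measurableTypeR R) -> \bar R})
    (F : R -> 'M[R]_(m, n)) : 'M[R]_(m, n) :=
  \matrix_(i, j) Rintegral mu setT (fun s => F s i j).

End LieAlgebra.

(** * Complexification *)

Section Complexification.
Variables (R : realType) (N : nat).
Local Notation C := (R[i]).
Local Notation MC := ('M[C]_N).

Definition cplx (m n : nat) (A B : 'M[R]_(m, n)) : 'M[C]_(m, n) :=
  \matrix_(i, j) Complex (A i j) (B i j).
Definition mxRe (m n : nat) (Z : 'M[C]_(m, n)) : 'M[R]_(m, n) :=
  map_mx (@complex.Re R) Z.
Definition mxIm (m n : nat) (Z : 'M[C]_(m, n)) : 'M[R]_(m, n) :=
  map_mx (@complex.Im R) Z.
Definition mxC (m n : nat) (A : 'M[R]_(m, n)) : 'M[C]_(m, n) := cplx A 0.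

Definition imC : C := Complex 0 1.

Definition killingC (L : {vspace 'M[R]_N}) (Z W : MC) : C :=
  Complex
    (killing L (mxRe Z) (mxRe W) - killing L (mxIm Z) (mxIm W))
    (killing L (mxRe Z) (mxIm W) + killing L (mxIm Z) (mxRe W)).

(* R^+ (b = true) and R^- (b = false). *)
Definition Rpm (r : 'End('M[R]_N)) (b : bool) (Z : MC) : MC :=
  cplx (r (mxRe Z)) (r (mxIm Z)) + (if b then imC else - imC) *: Z.

(* Limits, derivatives and integrals of complex matrices along the real line
   are those of the real and imaginary parts of the entries. *)
Definition is_mxderiveC (F : R -> MC) (s : R) (D : MC) : Prop :=
  is_mxderive (fun t => mxRe (F t)) s (mxRe D) /\
  is_mxderive (fun t => mxIm (F t)) s (mxIm D).

Definition mx_limC (l : set_system R) (F : R -> MC) : MC :=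
  \matrix_(i, j)
    Complex (lim ((fun s => complex.Re (F s i j)) @ l))
            (lim ((fun s => complex.Im (F s i j)) @ l)).

Definition mx_integralC (F : R -> MC) : MC :=
  cplx (mx_integral (@lebesgue_measure R) (fun s => mxRe (F s)))
       (mx_integral (@lebesgue_measure R) (fun s => mxIm (F s))).

(* U s s' = P exp(- \int_{s'}^s A(r) dr), with factors ordered from right (s')
   to left (s). *)
Definition path_ordered_exp (A : R -> MC) (U : R -> R -> MC) : Prop :=
  [/\ forall s', U s' s' = 1%:M,
      forall s s', U s s' \in unitmx &
      forall s s', exists D : MC,
        is_mxderiveC (fun t => U t s') s D /\ D *m invmx (U s s') = - A s].

(* U(s, -oo), U(+oo, s) and U(+oo, -oo). *)
Definition from_minfty (U : R -> R -> MC) (s : R) : MC :=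
  mx_limC (-oo : set_system R) (fun s' => U s s').
Definition to_pinfty (U : R -> R -> MC) (s : R) : MC :=
  mx_limC (+oo : set_system R) (fun s' => U s' s).
Definition whole_line (U : R -> R -> MC) : MC :=
  mx_limC (+oo : set_system R) (from_minfty U).

End Complexification.

(** * Poisson brackets of fields *)

(* A Poisson bracket on complex observables M -> R[i], bilinear over R[i].  The
   bracket of two fields taken at points is in general a distribution, so the
   bracket is partial: [pbdef f h] says that [pb f h] is defined.  Outside
   [pbdef] the value of [pb] is unspecified. *)
Record poisson_bracket (R : realType) (M : Type) := PoissonBracket {
  pbdef : (M -> R[i]) -> (M -> R[i]) -> Prop;
  pb :> (M -> R[i]) -> (M -> R[i]) -> M -> R[i];
  pbdef_sym : forall f h, pbdef f h -> pbdef h f;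
  pbdef_lin : forall (c : R[i]) f h k, pbdef f k -> pbdef h k ->
    pbdef (fun m => c * f m + h m) k;
  pbdef_mul : forall f h k, pbdef f k -> pbdef h k ->
    pbdef (fun m => f m * h m) k;
  pb_skew : forall f h, pbdef f h -> forall m, pb f h m = - pb h f m;
  pb_lin : forall (c : R[i]) f h k, pbdef f k -> pbdef h k ->
    forall m, pb (fun m' => c * f m' + h m') k m = c * pb f k m + pb h k m;
  pb_leibniz : forall f h k, pbdef f k -> pbdef h k ->
    forall m, pb (fun m' => f m' * h m') k m = f m * pb h k m + pb f k m * h m;
  pb_jacobi : forall f h k,
    pbdef f h -> pbdef h k -> pbdef k f ->
    pbdef f (pb h k) -> pbdef h (pb k f) -> pbdef k (pb f h) ->
    forall m, pb f (pb h k) m + pb h (pb k f) m + pb k (pb f h) m = 0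
}.

Section Fields.
Variables (R : realType) (N : nat) (M : Type) (P : poisson_bracket R M).
Local Notation C := (R[i]).
Local Notation MC := ('M[C]_N).

(* {F_1, H_2}: the entry at row (i, k), column (j, l) is {F_ij, H_kl}. *)
Definition pb12 (F H : M -> MC) (m : M) : 'M[C]_(N * N) :=
  \matrix_(p, q)
    P (fun m' => F m' (mxtens_unindex p).1 (mxtens_unindex q).1)
      (fun m' => H m' (mxtens_unindex p).2 (mxtens_unindex q).2) m.

Definition pb12_def (F H : M -> MC) : Prop :=
  forall i j k l, pbdef P (fun m => F m i j) (fun m => H m k l).

Definition test_function (phi : R -> R) : Prop :=
  continuous phi /\ bounded_fun phi.

(* The matrix observable \int ds phi(s) A(s). *)
Definition smear (A : M -> R -> 'M[R]_N) (phi : R -> R) (m : M) : MC :=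
  mxC (mx_integral (@lebesgue_measure R) (fun s => phi s *: A m s)).

Definition at_pt (A : M -> R -> 'M[R]_N) (s : R) (m : M) : MC := mxC (A m s).

(* {A_1(s), B_2(s')} = D(s) delta_{s s'}, as distributions in s: both sides are
   paired with phi(s) ds, the delta distribution being the Dirac measure at
   s'. *)
Definition pb12_delta (A B : M -> R -> 'M[R]_N)
    (D : M -> R -> 'M[R]_(N * N)) : Prop :=
  forall (phi : R -> R) (s' : R), test_function phi ->
    pb12_def (smear A phi) (at_pt B s') /\
    forall m, pb12 (smear A phi) (at_pt B s') m =
      mxC (mx_integral (dirac (s' : measurableTypeR R))
             (fun s => phi s *: D m s)).

(* What is required of a field configuration: values, continuity in s, decay
   at infinity and convergence of the integrals of X. *)
Definition admissible_fields (G : set 'M[R]_N) (L : {vspace 'M[R]_N})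
    (g X : R -> 'M[R]_N) : Prop :=
  [/\ forall s, G (g s), forall s, X s \in L,
      forall i j, continuous (fun s => g s i j),
      forall i j, continuous (fun s => X s i j) &
      forall i j,
        [/\ (fun s => X s i j) @ (+oo : set_system R) --> (0 : R),
            (fun s => X s i j) @ (-oo : set_system R) --> (0 : R) &
            (@lebesgue_measure R).-integrable setT
               (fun s => (X s i j)%:E)]].

(* Brackets of T(+oo, -oo) for the connection A = A(X): in the variation formula
     delta T(+oo, -oo) = - \int ds T(+oo, s) (delta A(s)) T(s, -oo)
   delta is replaced by {-, f}.  At the phase space point m this is the bracket
   with f of the observable below, in which the two factors T are frozen at m
   and only A varies. *)
Definition variation (A : M -> R -> MC) (U : M -> R -> R -> MC) (m : M)
    (m' : M) : MC :=
  - mx_integralC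
      (fun s => to_pinfty (U m) s *m A m' s *m from_minfty (U m) s).

(* The observables f for which the formula applies are those having a bracket
   with X(s), as a distribution in s. *)
Definition pb_by_variation (X : M -> R -> 'M[R]_N) (A : M -> R -> MC)
    (U : M -> R -> R -> MC) : Prop :=
  forall f : M -> C,
    (forall phi, test_function phi ->
       forall i j, pbdef P (fun m => smear X phi m i j) f) ->
    forall i j,
      pbdef P (fun m => whole_line (U m) i j) f /\
      forall m, P (fun m' => whole_line (U m') i j) f m =
                P (fun m' => variation A U m m' i j) f m.

(* The matrix U^-1 {U, f}. *)
Definition left_log_pb (U : M -> MC) (f : M -> C) (m : M) : MC :=
  invmx (U m) *m \matrix_(i, j) P (fun m' => U m' i j) f m.

(* The connection gamma R^{+-} X. *)
Definition connection (r : 'End('M[R]_N)) (gamma : R) (X : M -> R -> 'M[R]_N)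
    (b : bool) (m : M) (s : R) : MC :=
  (gamma%:C)%C *: Rpm r b (mxC (X m s)).

Definition delta_eps (L : {vspace 'M[R]_N}) (gamma : R)
    (T : bool -> M -> R -> R -> MC) (eps : 'M[R]_N) (f : M -> C) (m : M) : C :=
  - (2 * imC R * (gamma%:C)%C)^-1 *
    killingC L (mxC eps)
      (left_log_pb (fun m' => whole_line (T true m')) f m -
       left_log_pb (fun m' => whole_line (T false m')) f m).

Definition delta_eps_mx (L : {vspace 'M[R]_N}) (gamma : R)
    (T : bool -> M -> R -> R -> MC) (eps : 'M[R]_N) (F : M -> MC) (m : M)
    : MC :=
  \matrix_(i, j) delta_eps L gamma T eps (fun m' => F m' i j) m.

Definition Kfield (r : 'End('M[R]_N)) (T : bool -> M -> R -> R -> MC)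
    (eps : 'M[R]_N) (s : R) (m : M) : MC :=
  let Ad b := from_minfty (T b m) s *m mxC eps
                *m invmx (from_minfty (T b m) s) in
  (2 * imC R)^-1 *: Rpm r true (Ad false) -
  (2 * imC R)^-1 *: Rpm r false (Ad true).

End Fields.

(* Main.v *)
Require Import Defs.
From mathcomp Require Import ring lra measurable_realfun.

Set Implicit Arguments.
Unset Strict Implicit.
Unset Printing Implicit Defensive.

(* Integrating the variation formula against X only needs the bracket of f with
   smeared X, so with {X_1(s'), f} = D_1 delta(s' - s) it evaluates to
   T^{-1} {T, f} = - gamma V^{-1} R^{+-}(D) V, where V = T(s, -oo) and
   T = T(+oo, s) V.  Ad V preserves the complexified algebra and the Killing
   form, and R^{+-} has transpose - R^{-+}; hence delta_eps f = kappa(K(s), D),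
   and contracting the Casimir with K(s) gives g K and [X, K].
   Existence and invertibility of the limits T(s, -oo), T(+oo, s), their
   boundedness and continuity in s (so that they are test functions), and the
   invariance under Ad V all come from Gronwall estimates for linear equations
   with integrable coefficients. *)

(** * Complexified Lie algebra and Killing form *)

(** Three features of the definitions shape the work. The limits in [from_minfty], [to_pinfty] and
    [whole_line] are taken with [lim], which carries no information until convergence is proved.
    [path_ordered_exp] prescribes only the derivative in the first endpoint, so the composition law,
    the inverse and the derivative in the second endpoint have to be recovered from uniqueness of
    solutions. The growth estimates compare every equation with a function [alpha] proportional to
    the norm of X, through a bounded primitive [Phi] of it. They then use derivatives and
    monotonicity only, and integrability of X enters them through [Phi] alone. [killing] is
    meaningful on [L] only, which is why membership in the complexified algebra is carried along. *)

Section ComplexEntries.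
Variable R : realType.
Implicit Types x y : R[i].

Lemma ReD x y : complex.Re (x + y) = complex.Re x + complex.Re y.
Proof. by case: x => ? ?; case: y. Qed.

Lemma ImD x y : complex.Im (x + y) = complex.Im x + complex.Im y.
Proof. by case: x => ? ?; case: y. Qed.

Lemma ReM x y : complex.Re (x * y) =
  complex.Re x * complex.Re y - complex.Im x * complex.Im y.
Proof. by case: x => ? ?; case: y. Qed.

Lemma ImM x y : complex.Im (x * y) =
  complex.Re x * complex.Im y + complex.Im x * complex.Re y.
Proof. by case: x => ? ?; case: y. Qed.

Lemma complex_ext x y :
  complex.Re x = complex.Re y -> complex.Im x = complex.Im y -> x = y.
Proof. by case: x => ? ?; case: y => ? ? /= -> ->. Qed.

Lemma Re_sum (I : Type) (s : seq I) (Q : pred I) (F : I -> R[i]) :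
  complex.Re (\sum_(i <- s | Q i) F i) = \sum_(i <- s | Q i) complex.Re (F i).
Proof. exact: (big_morph _ ReD). Qed.

Lemma Im_sum (I : Type) (s : seq I) (Q : pred I) (F : I -> R[i]) :
  complex.Im (\sum_(i <- s | Q i) F i) = \sum_(i <- s | Q i) complex.Im (F i).
Proof. exact: (big_morph _ ImD). Qed.

Lemma mxCE m n (A : 'M[R]_(m, n)) : mxC A = map_mx (real_complex R) A.
Proof. by apply/matrixP => i j; rewrite !mxE. Qed.

Lemma mxReD m n (Z W : 'M[R[i]]_(m, n)) : mxRe (Z + W) = mxRe Z + mxRe W.
Proof. by apply/matrixP => i j; rewrite !mxE ReD. Qed.

Lemma mxImD m n (Z W : 'M[R[i]]_(m, n)) : mxIm (Z + W) = mxIm Z + mxIm W.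
Proof. by apply/matrixP => i j; rewrite !mxE ImD. Qed.

Lemma mxReZ m n c (Z : 'M[R[i]]_(m, n)) :
  mxRe (c *: Z) = complex.Re c *: mxRe Z - complex.Im c *: mxIm Z.
Proof. by apply/matrixP => i j; rewrite !mxE ReM. Qed.

Lemma mxImZ m n c (Z : 'M[R[i]]_(m, n)) :
  mxIm (c *: Z) = complex.Re c *: mxIm Z + complex.Im c *: mxRe Z.
Proof. by apply/matrixP => i j; rewrite !mxE ImM. Qed.

Lemma mxReM m n p (Z : 'M[R[i]]_(m, n)) (W : 'M[R[i]]_(n, p)) :
  mxRe (Z *m W) = mxRe Z *m mxRe W - mxIm Z *m mxIm W.
Proof.
apply/matrixP => i j; rewrite !mxE Re_sum -sumrB.
by apply: eq_bigr => k _; rewrite !mxE ReM.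
Qed.

Lemma mxImM m n p (Z : 'M[R[i]]_(m, n)) (W : 'M[R[i]]_(n, p)) :
  mxIm (Z *m W) = mxRe Z *m mxIm W + mxIm Z *m mxRe W.
Proof.
apply/matrixP => i j; rewrite !mxE Im_sum -big_split.
by apply: eq_bigr => k _; rewrite !mxE ImM.
Qed.

Lemma mxRe_cplx m n (A B : 'M[R]_(m, n)) : mxRe (cplx A B) = A.
Proof. by apply/matrixP => i j; rewrite !mxE. Qed.

Lemma mxIm_cplx m n (A B : 'M[R]_(m, n)) : mxIm (cplx A B) = B.
Proof. by apply/matrixP => i j; rewrite !mxE. Qed.

Lemma cplxK m n (Z : 'M[R[i]]_(m, n)) : cplx (mxRe Z) (mxIm Z) = Z.
Proof. by apply/matrixP => i j; rewrite !mxE; case: (Z i j). Qed.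

Lemma cplx_inj m n (Z W : 'M[R[i]]_(m, n)) :
  mxRe Z = mxRe W -> mxIm Z = mxIm W -> Z = W.
Proof. by move=> e f; rewrite -(cplxK Z) -(cplxK W) e f. Qed.

End ComplexEntries.

Definition mxCK := (mxRe_cplx, mxIm_cplx).

Section ComplexifiedLieAlgebra.
Variables (R : realType) (N : nat) (L : {vspace 'M[R]_N}).
Local Notation C := R[i].
Implicit Types (A B : 'M[R]_N) (Z W : 'M[C]_N).

Definition memC Z := mxRe Z \in L /\ mxIm Z \in L.

Lemma memC_mxC A : A \in L -> memC (mxC A).
Proof. by move=> AL; rewrite /memC /mxC !mxCK mem0v. Qed.

Lemma memCD Z W : memC Z -> memC W -> memC (Z + W).
Proof. by move=> [? ?] [? ?]; rewrite /memC mxReD mxImD !memvD. Qed.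

Lemma memCZ c Z : memC Z -> memC (c *: Z).
Proof. by move=> [? ?]; split; rewrite (mxReZ, mxImZ) ?memvB ?memvD ?memvZ. Qed.

Lemma memCB Z W : memC Z -> memC W -> memC (Z - W).
Proof. by move=> hZ hW; rewrite -scaleN1r; apply: memCD => //; apply: memCZ. Qed.

Lemma mxRe_lie Z W :
  mxRe (lie Z W) = lie (mxRe Z) (mxRe W) - lie (mxIm Z) (mxIm W).
Proof.
rewrite /lie -[- (W *m Z)]scaleN1r mxReD mxReZ !mxReM /= oppr0 scale0r subr0.
by rewrite scaleN1r; apply/matrixP => i j; rewrite !mxE; ring.
Qed.

Lemma mxIm_lie Z W :
  mxIm (lie Z W) = lie (mxRe Z) (mxIm W) + lie (mxIm Z) (mxRe W).
Proof.
rewrite /lie -[- (W *m Z)]scaleN1r mxImD mxImZ !mxImM /= oppr0 scale0r addr0.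
by rewrite scaleN1r; apply/matrixP => i j; rewrite !mxE; ring.
Qed.

Lemma memC_lie : lie_subalgebra L ->
  forall Z W, memC Z -> memC W -> memC (lie Z W).
Proof.
move=> hL Z W [? ?] [? ?].
split; first by rewrite mxRe_lie; apply: memvB; apply: hL.
by rewrite mxIm_lie; apply: memvD; apply: hL.
Qed.

Definition extC (f : 'M[R]_N -> R) Z : C := Complex (f (mxRe Z)) (f (mxIm Z)).

Lemma extC_is_linear (f : {linear 'M[R]_N -> R^o}) c Z W :
  extC f (c *: Z + W) = c * extC f Z + extC f W.
Proof.
rewrite /extC mxReD mxImD mxReZ mxImZ !linearD linearN !linearZ /=.
apply: complex_ext; rewrite ?ReD ?ImD ?ReM ?ImM /=.
all: rewrite /GRing.scale /=.
all: ring.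
Qed.

Local Notation bas := (vbasis L).

Lemma extC_linear_sum (f : {linear 'M[R]_N -> R^o}) (I : finType)
    (c : I -> C) (F : I -> 'M[C]_N) :
  extC f (\sum_i c i *: F i) = \sum_i c i * extC f (F i).
Proof.
apply: (big_rec2 (fun x y => extC f x = y)) => [|i x y _ <-].
  have -> : (0 : 'M[C]_N) = (-1) *: 0 + 0 by rewrite scaler0 addr0.
  by rewrite extC_is_linear mulN1r addNr.
exact: extC_is_linear.
Qed.

(** Row [i] holds the coordinates of the bracket with the [i]-th basis vector, so ad acts on row
    vectors and composition reverses products: ad Z after ad W is [adC W *m adC Z]. *)
Definition adC Z : 'M[C]_(\dim L) :=
  \matrix_(i, j) extC (coord bas j) (lie Z (mxC bas`_i)).

Definition adR A : 'M[R]_(\dim L) :=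
  \matrix_(i, j) coord bas j (lie A bas`_i).

Lemma mxRe_mxC A : mxRe (mxC A) = A. Proof. exact: mxRe_cplx. Qed.
Lemma mxIm_mxC A : mxIm (mxC A) = 0. Proof. exact: mxIm_cplx. Qed.

Lemma memC_coord Z : memC Z ->
  Z = \sum_j extC (coord bas j) Z *: mxC bas`_j.
Proof.
move=> [ZR ZI]; apply: cplx_inj.
  rewrite {1}(coord_vbasis ZR) (big_morph _ (@mxReD _ _ _) (_ : _ = 0)).
    by apply: eq_bigr => j _; rewrite mxReZ mxRe_mxC mxIm_mxC scaler0 subr0.
  by apply/matrixP => i j; rewrite !mxE.
rewrite {1}(coord_vbasis ZI) (big_morph _ (@mxImD _ _ _) (_ : _ = 0)).
  by apply: eq_bigr => j _; rewrite mxImZ mxRe_mxC mxIm_mxC scaler0 add0r.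
by apply/matrixP => i j; rewrite !mxE.
Qed.

Lemma lie_linearl c Z W Y : lie (c *: Z + W) Y = c *: lie Z Y + lie W Y.
Proof.
by rewrite /lie mulmxDl mulmxDr -scalemxAl -scalemxAr scalerBr opprD addrACA.
Qed.

Lemma adC_linear c Z W : adC (c *: Z + W) = c *: adC Z + adC W.
Proof. by apply/matrixP => i j; rewrite !mxE lie_linearl extC_is_linear. Qed.

Lemma adCE Z : adC Z = cplx (adR (mxRe Z)) (adR (mxIm Z)).
Proof.
apply/matrixP => i j; rewrite !mxE /extC mxRe_lie mxIm_lie mxRe_mxC mxIm_mxC.
by rewrite /lie mulmx0 mul0mx subr0 mulmx0 mul0mx subr0 subr0 add0r.
Qed.

Hypothesis hL : lie_subalgebra L.

Lemma vbasisL (i : 'I_(\dim L)) : bas`_i \in L.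
Proof. by apply: vbasis_mem; rewrite mem_nth // size_tuple. Qed.

(** Only [lie B] of a basis vector has to be expanded in the basis; [coord] is linear on the whole
    matrix space, so the outer argument [A] is arbitrary. The membership conditions of the linearity
    lemmas below inherit this asymmetry. *)
Lemma killing_trace A B : B \in L -> killing L A B = \tr (adR B *m adR A).
Proof.
move=> BL; rewrite /killing /mxtrace; apply: eq_bigr => i _.
rewrite {1}(coord_vbasis (hL BL (vbasisL i))) mxE.
rewrite /lie mulmx_sumr mulmx_suml -sumrB linear_sum /=.
apply: eq_bigr => j _.
rewrite -scalemxAl -scalemxAr -scalerBr linearZ /= !mxE.
by [].
Qed.

Lemma killingC_trace Z W : memC W -> killingC L Z W = \tr (adC W *m adC Z).
Proof.
move=> [WR WI]; rewrite /killingC !killing_trace // !adCE.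
apply: complex_ext => /=.
  rewrite /mxtrace Re_sum -sumrB; apply: eq_bigr => i _.
  rewrite !mxE Re_sum -sumrB; apply: eq_bigr => j _.
  by rewrite !mxE ReM.
rewrite /mxtrace Im_sum -big_split; apply: eq_bigr => i _ /=.
rewrite !mxE Im_sum -big_split; apply: eq_bigr => j _ /=.
by rewrite !mxE ImM addrC.
Qed.

Lemma killing_sym A B : A \in L -> B \in L -> killing L A B = killing L B A.
Proof. by move=> AL BL; rewrite !killing_trace // mxtrace_mulC. Qed.

Lemma killingC_sym Z W : memC Z -> memC W -> killingC L Z W = killingC L W Z.
Proof. by move=> ZL WL; rewrite (killingC_trace _ WL) (killingC_trace _ ZL); exact: mxtrace_mulC. Qed.

Lemma killingC_linearr c Z W Y : memC W -> memC Y ->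
  killingC L Z (c *: W + Y) = c * killingC L Z W + killingC L Z Y.
Proof.
move=> WL YL; rewrite (killingC_trace _ WL) (killingC_trace _ YL).
rewrite killingC_trace; last exact/memCD/YL/memCZ.
by rewrite adC_linear mulmxDl -scalemxAl linearD linearZ.
Qed.

Lemma killingC_linearl c Z W Y : memC Y ->
  killingC L (c *: Z + W) Y = c * killingC L Z Y + killingC L W Y.
Proof.
move=> YL; rewrite !(killingC_trace _ YL).
by rewrite adC_linear mulmxDr -scalemxAr linearD linearZ.
Qed.

Lemma lie_adC Z (i : 'I_(\dim L)) : memC Z ->
  lie Z (mxC bas`_i) = \sum_j adC Z i j *: mxC bas`_j.
Proof.
move=> ZL; have /memC_coord -> := memC_lie hL ZL (memC_mxC (vbasisL i)).
by apply: eq_bigr => j _; rewrite mxE.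
Qed.

(* In the basis of L, ad (Ad_g Z) is the conjugate of ad Z by the matrix of
   Ad_g, so the identity is the cyclicity of the trace. *)
Lemma killingC_Ad (g h : 'M[C]_N) Z W : g *m h = 1%:M -> h *m g = 1%:M ->
  (forall Y, memC Y -> memC (g *m Y *m h)) ->
  (forall Y, memC Y -> memC (h *m Y *m g)) ->
  memC Z -> memC W ->
  killingC L (g *m Z *m h) W = killingC L Z (h *m W *m g).
Proof.
have adC_conj : forall (g h : 'M[C]_N) Z, g *m h = 1%:M -> h *m g = 1%:M ->
  (forall Y, memC Y -> memC (g *m Y *m h)) ->
  (forall Y, memC Y -> memC (h *m Y *m g)) -> memC Z ->
  adC (g *m Z *m h) =
    (\matrix_(i, j) extC (coord bas j) (h *m mxC bas`_i *m g)) *m adC Z *m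
    (\matrix_(i, j) extC (coord bas j) (g *m mxC bas`_i *m h)).
  move=> {}g {}h {}Z gh hg gL hL' ZL; apply/matrixP => i l; rewrite [LHS]mxE.
  have -> : lie (g *m Z *m h) (mxC bas`_i) =
            g *m lie Z (h *m mxC bas`_i *m g) *m h.
    rewrite /lie mulmxBr mulmxBl !mulmxA; congr (_ - _).
      by rewrite -[RHS]mulmxA gh mulmx1.
    by rewrite gh mul1mx.
  have bL j : memC (mxC bas`_(j : 'I_(\dim L))) by exact/memC_mxC/vbasisL.
  rewrite (memC_coord (hL' _ (bL i))) /lie mulmx_sumr mulmx_suml -sumrB.
  set S := \matrix_(_, _) _; set S' := \matrix_(_, _) _.
  have -> : \sum_j (Z *m (extC (coord bas j) (h *m mxC bas`_i *m g) *: mxC bas`_j)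
      - extC (coord bas j) (h *m mxC bas`_i *m g) *: mxC bas`_j *m Z) =
      \sum_k (S *m adC Z) i k *: mxC bas`_k.
    under eq_bigr => j _.
      rewrite -scalemxAr -scalemxAl -scalerBr -/(lie _ _) lie_adC // scaler_sumr.
      over.
    rewrite exchange_big; apply: eq_bigr => k _; rewrite mxE scaler_suml.
    by apply: eq_bigr => j _; rewrite scalerA [S i j]mxE.
  rewrite mulmx_sumr mulmx_suml.
  under eq_bigr => k _ do rewrite -scalemxAr -scalemxAl.
  rewrite extC_linear_sum [RHS]mxE; apply: eq_bigr => k _.
  by rewrite [S' k l]mxE.
move=> gh hg gL hL' ZL WL; rewrite (killingC_trace _ WL).
rewrite (killingC_trace _ (hL' _ WL)).
rewrite (adC_conj _ _ _ gh) // (adC_conj _ _ _ hg) //.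
by move: (adC W) (adC Z) => w z; rewrite mulmxA mxtrace_mulC !mulmxA.
Qed.

(** * The operators R^+ and R^- on the complexified algebra *)

Section Rmatrix.
Variable r : 'End('M[R]_N).
Hypothesis rL : endo_on L r.

Lemma endo_mem A : A \in L -> r A \in L.
Proof. by move=> AL; apply: (subvP rL); apply: memv_img. Qed.

Lemma memC_Rpm e Z : memC Z -> memC (Rpm r e Z).
Proof.
move=> ZL; apply: memCD; last exact: memCZ.
by case: ZL => ? ?; rewrite /memC !mxCK !endo_mem.
Qed.

Lemma Rpm_linear e c Z W : Rpm r e (c *: Z + W) = c *: Rpm r e Z + Rpm r e W.
Proof.
rewrite /Rpm; set i := if e then _ else _.
rewrite !scalerDr [i *: (c *: Z)]scalerA [i * c]mulrC -scalerA addrACA.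
congr (_ + _); apply: cplx_inj.
  by rewrite !mxReD !mxReZ !mxCK linearD linearB !linearZ.
by rewrite !mxImD !mxImZ !mxCK !linearD !linearZ.
Qed.

(** R is skew and multiples of the identity are symmetric, so the transpose of R + i is - R + i = -
    (R - i); hence the flipped flag. *)
Lemma Rpm_skew e Z W : killing_skew L r -> memC Z -> memC W ->
  killingC L (Rpm r e Z) W = - killingC L Z (Rpm r (~~ e) W).
Proof.
move=> skew ZL WL.
have rZL : memC (cplx (r (mxRe Z)) (r (mxIm Z))).
  by case: ZL => ? ?; rewrite /memC !mxCK !endo_mem.
have rWL : memC (cplx (r (mxRe W)) (r (mxIm W))).
  by case: WL => ? ?; rewrite /memC !mxCK !endo_mem.
have RpmE e' Y : Rpm r e' Y = (if e' then imC R else - imC R) *: Y +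
    cplx (r (mxRe Y)) (r (mxIm Y)) by rewrite /Rpm addrC.
rewrite !RpmE killingC_linearl // killingC_linearr //.
have -> : killingC L (cplx (r (mxRe Z)) (r (mxIm Z))) W =
  - killingC L Z (cplx (r (mxRe W)) (r (mxIm W))).
  case: ZL WL => ? ? [? ?]; rewrite /killingC !mxCK !skew //.
  by apply: complex_ext => /=; ring.
by case: e; rewrite /= ?mulNr opprD ?opprK addrC.
Qed.

End Rmatrix.

Lemma memC0 : memC 0.
Proof.
have -> : (0 : 'M[C]_N) = mxC 0 by rewrite mxCE map_mx0.
exact/memC_mxC/mem0v.
Qed.

Lemma killing_linearr A c B D : B \in L -> D \in L ->
  killing L A (c *: B + D) = c * killing L A B + killing L A D.
Proof.
move=> BL DL; rewrite (killing_trace _ BL) (killing_trace _ DL).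
rewrite killing_trace ?memvD ?memvZ //.
have -> : adR (c *: B + D) = c *: adR B + adR D.
  apply/matrixP => i j; rewrite !mxE /lie mulmxDl mulmxDr -scalemxAl -scalemxAr.
  by rewrite opprD addrACA -scalerBr linearD linearZ.
by rewrite mulmxDl -scalemxAl linearD linearZ.
Qed.

Lemma killing0r A : killing L A 0 = 0.
Proof.
have := killing_linearr A 1 (mem0v L) (mem0v L).
by rewrite scale1r addr0 mul1r => /eqP; rewrite -subr_eq0 opprD addNKr oppr_eq0 => /eqP.
Qed.

Lemma killingC0r Z : killingC L Z 0 = 0.
Proof.
have -> : (0 : 'M[C]_N) = mxC 0 by rewrite mxCE map_mx0.
by rewrite /killingC mxRe_mxC mxIm_mxC !killing0r subr0 addr0.
Qed.

Lemma killingC_scaler c Z W : memC W -> killingC L Z (c *: W) = c * killingC L Z W.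
Proof.
by move=> WL; rewrite -[c *: W]addr0 killingC_linearr ?killingC0r ?addr0 //; exact: memC0.
Qed.

(** * Nondegeneracy of the Killing form and symmetry of the Casimir *)

Section Casimir.
Variables (n : nat) (a b : 'I_n -> 'M[R]_N).
Hypothesis Cab : casimir_decomposition L a b.

Lemma killing_sumr A (I : finType) (c : I -> R) (F : I -> 'M[R]_N) :
  (forall i, F i \in L) ->
  killing L A (\sum_i c i *: F i) = \sum_i c i * killing L A (F i).
Proof.
move=> FL; suff [] : \sum_i c i *: F i \in L /\
  killing L A (\sum_i c i *: F i) = \sum_i c i * killing L A (F i) by [].
apply: (big_rec2 (fun x y => x \in L /\ killing L A x = y)) => [|i x y _ [xL <-]].
  by rewrite mem0v killing0r.
by rewrite memvD ?memvZ ?killing_linearr.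
Qed.

(** The Casimir identity rebuilds [A] from its pairings with the [b k], so an [A] orthogonal to [L]
    is the zero combination. *)
Lemma killing_nondegenerate A : A \in L ->
  (forall B, B \in L -> killing L A B = 0) -> A = 0.
Proof.
case: Cab => aL bL ab AL A0; rewrite -(ab A AL) big1 // => k _.
by rewrite killing_sym // A0 // scale0r.
Qed.

(** The defining identity contracts the second tensor factor, but X sits in the first factor of the
    brackets, so the contraction over [a k] is the one required. Pairing the left side with [B]
    gives [killing L A] of the Casimir expansion of [B], and nondegeneracy concludes. *)
Lemma casimir_flip A : A \in L -> \sum_k killing L A (a k) *: b k = A.
Proof.
case: (Cab) => aL bL ab AL; apply/eqP; rewrite -subr_eq0; apply/eqP.
have SL : \sum_k killing L A (a k) *: b k \in L.
  by apply: memv_suml => k _; rewrite memvZ.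
apply: killing_nondegenerate => [|B BL]; first exact: memvB.
rewrite killing_sym ?memvB //.
rewrite addrC -scaleN1r killing_linearr // mulN1r killing_sumr //.
apply/eqP; rewrite addrC subr_eq0 killing_sym // -{2}(ab B BL).
rewrite killing_sumr //; apply/eqP; apply: eq_bigr => k _.
by rewrite mulrC killing_sym // (killing_sym AL).
Qed.

Lemma casimirC_flip Z : memC Z ->
  \sum_k killingC L Z (mxC (a k)) *: mxC (b k) = Z.
Proof.
case: (Cab) => aL bL ab [ZR ZI].
have kE k : killingC L Z (mxC (a k)) =
    Complex (killing L (mxRe Z) (a k)) (killing L (mxIm Z) (a k)).
  by rewrite /killingC mxRe_mxC mxIm_mxC !killing0r subr0 add0r.
apply: cplx_inj.
  rewrite (big_morph _ (@mxReD _ _ _) (_ : _ = 0)); last first.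
    by apply/matrixP => i j; rewrite !mxE.
  rewrite -[RHS](casimir_flip ZR); apply: eq_bigr => k _.
  by rewrite mxReZ kE mxRe_mxC mxIm_mxC scaler0 subr0.
rewrite (big_morph _ (@mxImD _ _ _) (_ : _ = 0)); last first.
  by apply/matrixP => i j; rewrite !mxE.
rewrite -[RHS](casimir_flip ZI); apply: eq_bigr => k _.
by rewrite mxImZ kE mxRe_mxC mxIm_mxC scaler0 add0r.
Qed.

End Casimir.

End ComplexifiedLieAlgebra.

(** * Gronwall estimates on the real line *)

Section RealLine.
Variable R : realType.
Implicit Types f df : R -> R.

Lemma is_derive_ndecr f df : (forall s, is_derive s (1 : R) f (df s)) ->
  (forall s, 0 <= df s) -> {homo f : x y / x <= y}.
Proof.
move=> fdf df0 x y xy.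
apply: (@ger0_derive1_ndecr _ f x y) => //.
- by move=> s _; rewrite derive1E derive_val.
- apply: continuous_subspaceT => s; apply: differentiable_continuous.
  exact/derivable1_diffP.
Qed.

Lemma is_derive_continuous f df : (forall s, is_derive s (1 : R) f (df s)) ->
  continuous f.
Proof.
move=> fdf s; apply: differentiable_continuous; exact/derivable1_diffP.
Qed.

Lemma ndecr_bounded_cvg f (B : R) : {homo f : x y / x <= y} ->
  (forall s, `|f s| <= B) ->
  (exists l : R, f @ (+oo : set_system R) --> l) /\
  (exists l : R, f @ (-oo : set_system R) --> l).
Proof.
move=> f_homo f_bnd; split.
  exists (sup (range f)); apply: nondecreasing_cvgr => //.
  by exists B => _ [s _ <-]; apply: le_trans (f_bnd s); exact: ler_norm.
(* Rotation by a half-turn about the origin keeps [f] nondecreasing and exchanges the two ends of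
   the line. *)
pose h s := - f (- s); exists (- sup (range h)).
have hl : h @ (+oo : set_system R) --> sup (range h).
  apply: nondecreasing_cvgr => [x y xy|].
    by rewrite /h lerN2 f_homo // lerN2.
  exists B => _ [s _ <-]; apply: le_trans (f_bnd (- s)).
  by rewrite -normrN ler_norm.
have -> : f = fun s => - h (- s) by apply/funext => s; rewrite /h !opprK.
apply: cvgN; apply/cvgNy_compNP.
by under eq_fun do rewrite /= opprK.
Qed.

Section DeriveRules.
Variables (s : R) (f g : R -> R) (a b : R).
Hypotheses (fa : is_derive s (1 : R) f a) (gb : is_derive s (1 : R) g b).

Lemma is_derive_addf : is_derive s (1 : R) (fun t => f t + g t) (a + b).
Proof. exact: is_deriveD. Qed.

Lemma is_derive_oppf : is_derive s (1 : R) (fun t => - f t) (- a).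
Proof. exact: is_deriveN. Qed.

Lemma is_derive_subf : is_derive s (1 : R) (fun t => f t - g t) (a - b).
Proof. exact: is_deriveB. Qed.

Lemma is_derive_mulf :
  is_derive s (1 : R) (fun t => f t * g t) (f s * b + a * g s).
Proof. by apply: is_derive_eq; rewrite /GRing.scale /= [a * _]mulrC. Qed.

Lemma is_derive_expf : is_derive s (1 : R) (fun t => expR (f t)) (expR (f s) * a).
Proof. exact: is_derive1_comp. Qed.

Lemma is_derive_valE (c : R) : a = c -> is_derive s (1 : R) f c.
Proof. by move=> <-. Qed.

Lemma is_derive_constf (c : R) : is_derive s (1 : R) (fun=> c) 0.
Proof. exact: is_derive_cst. Qed.

End DeriveRules.

Lemma is_derive_sumf (I : finType) s (f : I -> R -> R) (a : I -> R) :
  (forall i, is_derive s (1 : R) (f i) (a i)) ->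
  is_derive s (1 : R) (fun t => \sum_i f i t) (\sum_i a i).
Proof.
move=> fa; have -> : (fun t => \sum_i f i t) = \sum_i f i.
  by apply/funext => t; rewrite fct_sumE.
by elim/big_ind2 : _ => // [|] *; [exact: is_derive_cst|exact: is_deriveD].
Qed.

(** Converts integrability of the coefficient into the data used by the Gronwall estimates; the
    primitive starts at -oo and is bounded by the total integral. *)
Lemma bounded_primitive f : continuous f -> (forall s, 0 <= f s) ->
  (@lebesgue_measure R).-integrable setT (EFin \o f) ->
  exists F B, (forall s, is_derive s (1 : R) F (f s)) /\
              (forall s, `|F s| <= B).
Proof.
move=> fc f0 fi; pose mu := @lebesgue_measure R.
have fiA (A : set R) : measurable A -> mu.-integrable A (EFin \o f).
  by move=> mA; apply: integrableS fi.
exists (fun x => \int[mu]_(t in [set` `]-oo, x]]) f t)%R, (\int[mu]_t f t)%R.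
split=> s.
  have ltNyBRight (u : R) : (-oo%O < BRight u :> itv_bound R)%E by rewrite ltNyr.
  (* The fundamental theorem is applied at a point inside a half-line, and [s + 1] is an arbitrary
     end to the right of [s]. *)
  have ss1 : s < s + 1 by rewrite ltrDl.
  have [dF Fs] := @continuous_FTC1 R f -oo%O s (s + 1) ss1
    (fiA _ (measurable_itv _)) (ltNyBRight s) (fc s).
  by split=> //; rewrite -derive1E Fs.
rewrite ger0_norm; last by apply: Rintegral_ge0.
rewrite Rintegral_mkcond; apply: le_Rintegral => //.
- rewrite -restrict_EFin; move: (fiA _ (measurable_itv `]-oo, s])).
  by move=> /integrable_mkcond; apply; exact: measurable_itv.
- by move=> t _; rewrite patchE; case: ifP.
Qed.

End RealLine.

Section Gronwall.
Variables (R : realType) (I : finType) (alpha Phi : R -> R).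
Variables (y dy : I -> R -> R).
Hypothesis alpha_ge0 : forall s, 0 <= alpha s.
Hypothesis dPhi : forall s, is_derive s (1 : R) Phi (alpha s).
Hypothesis dyE : forall p s, is_derive s (1 : R) (y p) (dy p s).
Hypothesis dy_le : forall p s, `|dy p s| <= alpha s * \sum_q `|y q s|.

(** Squares instead of absolute values, so that the energy is differentiable. *)
Let E s := \sum_p y p s ^+ 2.
Let dE s := \sum_p (2 * y p s * dy p s).
(** The 2 comes from differentiating squares, the cardinal from the Cauchy-Schwarz bound of the
    squared l1 norm by the sum of squares. *)
Let c : R := 2 * #|I|%:R.

Let is_deriveE s : is_derive s (1 : R) E (dE s).
Proof.
apply: is_derive_sumf => p; under eq_fun do rewrite expr2.
by apply: (is_derive_valE (is_derive_mulf (dyE p s) (dyE p s))); ring.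
Qed.

Let E_ge0 s : 0 <= E s.
Proof. by apply: sumr_ge0 => p _; rewrite sqr_ge0. Qed.

Let cauchy s : (\sum_p `|y p s|) ^+ 2 <= #|I|%:R * E s.
Proof.
rewrite expr2 big_distrlr /=.
apply: (@le_trans _ _ (\sum_p \sum_q ((y p s ^+ 2 + y q s ^+ 2) / 2))).
  apply: ler_sum => p _; apply: ler_sum => q _.
  rewrite -[y p s ^+ 2]real_normK ?num_real // -[y q s ^+ 2]real_normK ?num_real //.
  have := sqr_ge0 (`|y p s| - `|y q s|); nra.
have -> : \sum_p \sum_q ((y p s ^+ 2 + y q s ^+ 2) / 2) =
    \sum_p ((y p s ^+ 2 *+ #|I| + E s) / 2).
  by apply: eq_bigr => p _; rewrite -mulr_suml big_split /= sumr_const.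
rewrite -mulr_suml big_split /= sumrMnl sumr_const.
have -> : \sum_p y p s ^+ 2 = E s by [].
by rewrite mulrDl -splitr mulr_natl.
Qed.

Let dE_le s : `|dE s| <= c * alpha s * E s.
Proof.
apply: le_trans (ler_norm_sum _ _ _) _.
apply: (@le_trans _ _ (2 * alpha s * (\sum_p `|y p s|) ^+ 2)); last first.
  by rewrite /c; have := cauchy s; have := alpha_ge0 s; nra.
set S := \sum_p `|y p s|.
have -> : 2 * alpha s * S ^+ 2 = \sum_p 2 * `|y p s| * (alpha s * S).
  by rewrite -mulr_suml -mulr_sumr -/S; ring.
apply: ler_sum => p _; rewrite !normrM ger0_norm //.
by apply: ler_wpM2l; [rewrite mulr_ge0 | exact: dy_le].
Qed.

(** From [dE_le], the product of [E] with [expR (- c * Phi)] is nonincreasing and its product with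
    [expR (c * Phi)] is nondecreasing; the first serves times after [s0], the second times before
    it. *)
Lemma gronwall s0 s : E s <= E s0 * expR (c * `|Phi s - Phi s0|).
Proof.
have dexp (k : R) (u : R) : is_derive u (1 : R) (fun t => E t * expR (k * Phi t))
    ((dE u + k * alpha u * E u) * expR (k * Phi u)).
  apply: (is_derive_valE (is_derive_mulf (is_deriveE u)
    (is_derive_expf (is_derive_mulf (is_derive_constf u k) (dPhi u))))).
  by ring.
have ndP := is_derive_ndecr dPhi alpha_ge0.
have [s0s|/ltW ss0] := leP s0 s.
  have /(_ s0 s s0s) : {homo (fun t => - (E t * expR (- c * Phi t))) : x y / x <= y}.
    apply: (is_derive_ndecr (fun u => is_derive_oppf (dexp (- c) u))).
    move=> u; rewrite -mulNr mulr_ge0 ?expR_ge0 //.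
    by have := dE_le u; rewrite ler_norml => /andP[]; lra.
  rewrite lerN2 => le1; rewrite ger0_norm ?subr_ge0 ?ndP //.
  have -> : E s0 * expR (c * (Phi s - Phi s0)) =
      E s0 * expR (- c * Phi s0) * expR (c * Phi s).
    by rewrite -mulrA -expRD; congr (_ * expR _); ring.
  have {1}-> : E s = E s * expR (- c * Phi s) * expR (c * Phi s).
    by rewrite -mulrA -expRD -mulrDl addNr mul0r expR0 mulr1.
  by rewrite ler_wpM2r ?expR_ge0.
have /(_ s s0 ss0) : {homo (fun t => (E t * expR (c * Phi t))) : x y / x <= y}.
  apply: (is_derive_ndecr (dexp c)).
  move=> u; rewrite mulr_ge0 ?expR_ge0 //.
  by have := dE_le u; rewrite ler_norml => /andP[]; lra.
move=> le1; rewrite ler0_norm ?subr_le0 ?ndP // opprB mulrBr expRD mulrA expRN.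
by rewrite ler_pdivlMr ?expR_gt0.
Qed.

Lemma gronwall_eq0 s0 : (forall p, y p s0 = 0) -> forall p s, y p s = 0.
Proof.
move=> y0 p s; have := gronwall s0 s.
rewrite [E s0]big1 => [|q _]; last by rewrite y0 expr0n.
rewrite mul0r => Es; apply/eqP; rewrite -sqrf_eq0; apply/eqP/le_anti.
rewrite sqr_ge0 andbT; apply: le_trans Es.
by rewrite /E (bigD1 p) //= lerDl sumr_ge0 // => q _; rewrite sqr_ge0.
Qed.

Hypothesis Phi_bounded : exists B, forall s, `|Phi s| <= B.

Lemma gronwall_bounded : exists K, forall p s, `|y p s| <= K.
Proof.
(* The summand 1 avoids a square root, since |y| <= 1 + y^2; [B + B] bounds the increment of [Phi]
   from 0. *)
case: Phi_bounded => B PB; exists (1 + E 0 * expR (c * (B + B))) => p s.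
apply: (@le_trans _ _ (1 + E s)).
  have : y p s ^+ 2 <= E s.
    by rewrite /E (bigD1 p) //= lerDl sumr_ge0 // => q _; rewrite sqr_ge0.
  rewrite -real_normK ?num_real //; have := sqr_ge0 (`|y p s| - 1); nra.
rewrite lerD2l; apply: le_trans (gronwall 0 s) _; apply: ler_wpM2l => //.
rewrite ler_expR; apply: ler_wpM2l; first by rewrite mulr_ge0.
by apply: le_trans (ler_normB _ _) _; apply: lerD.
Qed.

(** Boundedness of [y] gives |y'| <= k alpha, so [y + k Phi] is nondecreasing and bounded. It
    converges at both ends, as does [Phi], and the limit of [y] is a difference. *)
Lemma gronwall_cvg p :
  (exists l : R, y p @ (+oo : set_system R) --> l) /\
  (exists l : R, y p @ (-oo : set_system R) --> l).
Proof.
have [K yK] := gronwall_bounded; have [B PB] := Phi_bounded.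
have K0 : 0 <= K by apply: le_trans (yK p 0).
pose k := K *+ #|I|.
have [[lP hP] [lM hM]] :
  (exists l : R, Phi @ (+oo : set_system R) --> l) /\
  (exists l : R, Phi @ (-oo : set_system R) --> l).
  exact: (ndecr_bounded_cvg (is_derive_ndecr dPhi alpha_ge0) PB).
have [[lP' hP'] [lM' hM']] :
  (exists l : R, (fun s => y p s + k * Phi s) @ (+oo : set_system R) --> l) /\
  (exists l : R, (fun s => y p s + k * Phi s) @ (-oo : set_system R) --> l).
  apply: (@ndecr_bounded_cvg _ _ (K + k * B)) => [|s].
    apply: (is_derive_ndecr (fun s => is_derive_addf (dyE p s)
      (is_derive_mulf (is_derive_constf s k) (dPhi s)))) => s.
    rewrite mul0r addr0.
    have : \sum_q `|y q s| <= k.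
      apply: le_trans (_ : \sum_(q : I) K <= _); first exact: ler_sum.
      by rewrite sumr_const.
    by have := dy_le p s; rewrite ler_norml => /andP[+ _]; have := alpha_ge0 s; nra.
  apply: le_trans (ler_normD _ _) _; apply: lerD => //.
  by rewrite normrM ger0_norm ?mulrn_wge0 // ler_wpM2l // mulrn_wge0.
have yE : y p = fun s => (y p s + k * Phi s) - k * Phi s.
  by apply/funext => s; rewrite addrK.
split; [exists (lP' - k * lP) | exists (lM' - k * lM)]; rewrite yE.
  by apply: cvgB => //; apply: cvgMr.
by apply: cvgB => //; apply: cvgMr.
Qed.

End Gronwall.

(** * Calculus of complex matrix functions *)

Section ComplexCalculus.
Variable R : realType.
Local Notation C := R[i].
Implicit Types f g : R -> C.

Definition is_deriveC f s (d : C) :=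
  is_derive s (1 : R) (fun t => complex.Re (f t)) (complex.Re d) /\
  is_derive s (1 : R) (fun t => complex.Im (f t)) (complex.Im d).

Lemma is_deriveC_cst (c : C) s : is_deriveC (fun=> c) s 0.
Proof. by split; apply: is_derive_constf. Qed.

Lemma is_deriveC_add f g s a b : is_deriveC f s a -> is_deriveC g s b ->
  is_deriveC (fun t => f t + g t) s (a + b).
Proof.
move=> [fr fi] [gr gi]; rewrite /is_deriveC ReD ImD.
under eq_fun do rewrite ReD; under [X in _ /\ is_derive _ _ X _]eq_fun do rewrite ImD.
by split; apply: is_derive_addf.
Qed.

Lemma is_deriveC_mul f g s a b : is_deriveC f s a -> is_deriveC g s b ->
  is_deriveC (fun t => f t * g t) s (f s * b + a * g s).
Proof.
move=> [fr fi] [gr gi]; rewrite /is_deriveC ReD ImD !ReM !ImM.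
under eq_fun do rewrite ReM; under [X in _ /\ is_derive _ _ X _]eq_fun do rewrite ImM.
split.
  by apply: (is_derive_valE (is_derive_subf (is_derive_mulf fr gr)
    (is_derive_mulf fi gi))); ring.
by apply: (is_derive_valE (is_derive_addf (is_derive_mulf fr gi)
  (is_derive_mulf fi gr))); ring.
Qed.

Lemma is_deriveC_sum (I : finType) (f : I -> R -> C) s (a : I -> C) :
  (forall i, is_deriveC (f i) s (a i)) ->
  is_deriveC (fun t => \sum_i f i t) s (\sum_i a i).
Proof.
move=> fa; rewrite /is_deriveC Re_sum Im_sum.
under eq_fun do rewrite Re_sum.
under [X in _ /\ is_derive _ _ X _]eq_fun do rewrite Im_sum.
by split; apply: is_derive_sumf => i; have [] := fa i.
Qed.

Definition derivableC f s := exists d, is_deriveC f s d.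

Lemma derivableC_prod (I : Type) (r : seq I) (f : I -> R -> C) s :
  (forall i, derivableC (f i) s) -> derivableC (fun t => \prod_(i <- r) f i t) s.
Proof.
move=> fd; elim: r => [|i r [d rd]].
  by under eq_fun do rewrite big_nil; exists 0; apply: is_deriveC_cst.
under eq_fun do rewrite big_cons.
by have [e ie] := fd i; eexists; apply: is_deriveC_mul; eassumption.
Qed.

Lemma derivableC_sum (I : finType) (f : I -> R -> C) s :
  (forall i, derivableC (f i) s) -> derivableC (fun t => \sum_i f i t) s.
Proof. by move=> /choice[d fd]; eexists; apply: is_deriveC_sum; eassumption. Qed.

Lemma derivableC_mul f g s : derivableC f s -> derivableC g s ->
  derivableC (fun t => f t * g t) s.
Proof. by move=> [a fa] [b gb]; eexists; apply: is_deriveC_mul; eassumption. Qed.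

Lemma derivableC_cst (c : C) s : derivableC (fun=> c) s.
Proof. by exists 0; apply: is_deriveC_cst. Qed.

Lemma derivableC_inv f s : (forall t, f t != 0) -> derivableC f s ->
  derivableC (fun t => (f t)^-1) s.
Proof.
move=> f0 [d [dr di]].
(* [n2] is the squared modulus: 1/z has real part Re z / |z|^2 and imaginary part - Im z / |z|^2. *)
pose n2 t := complex.Re (f t) * complex.Re (f t) + complex.Im (f t) * complex.Im (f t).
have n20 : n2 s != 0.
  apply: contra (f0 s); rewrite /n2 -!expr2 paddr_eq0 ?sqr_ge0 // !sqrf_eq0.
  by case: (f s) => x y /= /andP[/eqP-> /eqP->].
have dn := is_deriveV n20 (is_derive_addf (is_derive_mulf dr dr) (is_derive_mulf di di)).
have := is_derive_mulf dr dn; set a := (X in is_derive _ _ _ X) => da.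
have := is_derive_oppf (is_derive_mulf di dn).
set b := (X in is_derive _ _ _ X) => db.
exists (Complex a b); split => /=.
  rewrite (_ : (fun t => complex.Re (f t)^-1) =
    (fun t => complex.Re (f t) * (n2 t)^-1)) //.
  by apply/funext => t; rewrite /n2 -!expr2; case: (f t).
rewrite (_ : (fun t => complex.Im (f t)^-1) =
  (fun t => - (complex.Im (f t) * (n2 t)^-1))) //.
by apply/funext => t; rewrite /n2 -!expr2; case: (f t).
Qed.

Lemma derivableC_det n (F : R -> 'M[C]_n) s :
  (forall i j, derivableC (fun t => F t i j) s) ->
  derivableC (fun t => \det (F t)) s.
Proof.
move=> dF; apply: derivableC_sum => p; apply: derivableC_mul.
  exact: derivableC_cst.
by apply: derivableC_prod => i.
Qed.

(** By the cofactor formula each entry of the inverse is a minor times a sign, divided by the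
    determinant, and determinants are polynomial in the entries. *)
Lemma derivableC_invmx n (F : R -> 'M[C]_n) s :
  (forall t, F t \in unitmx) ->
  (forall i j, derivableC (fun t => F t i j) s) ->
  forall i j, derivableC (fun t => invmx (F t) i j) s.
Proof.
move=> Fu dF i j.
have -> : (fun t => invmx (F t) i j) =
    (fun t => (\det (F t))^-1 * ((-1) ^+ (j + i) * \det (row' j (col' i (F t))))).
  by apply/funext => t; rewrite /invmx Fu !mxE.
apply: derivableC_mul.
  apply: derivableC_inv; last exact: derivableC_det.
  by move=> t; rewrite -unitfE -unitmxE.
apply: derivableC_mul; first exact: derivableC_cst.
by apply: derivableC_det => k l; under eq_fun do rewrite !mxE.
Qed.

Lemma is_mxderiveCP N (F : R -> 'M[C]_N) s D :
  is_mxderiveC F s D <-> forall i j, is_deriveC (fun t => F t i j) s (D i j).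
Proof.
have eRe i j : (fun t => mxRe (F t) i j) = (fun t => complex.Re (F t i j)).
  by apply/funext => t; rewrite mxE.
have eIm i j : (fun t => mxIm (F t) i j) = (fun t => complex.Im (F t i j)).
  by apply/funext => t; rewrite mxE.
split=> [[hR hI] i j|h].
  by have := hR i j; have := hI i j; rewrite eRe eIm !mxE.
by split=> i j; rewrite ?eRe ?eIm mxE; have [] := h i j.
Qed.

Section MatrixDerive.
Variable N : nat.
Implicit Types F H : R -> 'M[C]_N.

Lemma is_mxderiveC_mul F H s A B : is_mxderiveC F s A -> is_mxderiveC H s B ->
  is_mxderiveC (fun t => F t *m H t) s (F s *m B + A *m H s).
Proof.
move=> /is_mxderiveCP dF /is_mxderiveCP dH; apply/is_mxderiveCP => i j.
under eq_fun do rewrite mxE.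
rewrite !mxE -big_split /=.
by apply: is_deriveC_sum => k; apply: is_deriveC_mul.
Qed.

Lemma is_mxderiveC_add F H s A B : is_mxderiveC F s A -> is_mxderiveC H s B ->
  is_mxderiveC (fun t => F t + H t) s (A + B).
Proof.
move=> /is_mxderiveCP dF /is_mxderiveCP dH; apply/is_mxderiveCP => i j.
by under eq_fun do rewrite mxE; rewrite mxE; apply: is_deriveC_add.
Qed.

Lemma is_mxderiveC_cst (A : 'M[C]_N) s : is_mxderiveC (fun=> A) s 0.
Proof. by apply/is_mxderiveCP => i j; rewrite mxE; apply: is_deriveC_cst. Qed.

Lemma is_deriveC_unique f s a b : is_deriveC f s a -> is_deriveC f s b -> a = b.
Proof.
move=> [ar ai] [br bi]; apply: complex_ext.
  by rewrite -(@derive_val _ _ _ _ _ _ _ ar) -(@derive_val _ _ _ _ _ _ _ br).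
by rewrite -(@derive_val _ _ _ _ _ _ _ ai) -(@derive_val _ _ _ _ _ _ _ bi).
Qed.

Lemma is_mxderiveC_unique F s A B :
  is_mxderiveC F s A -> is_mxderiveC F s B -> A = B.
Proof.
move=> /is_mxderiveCP dA /is_mxderiveCP dB; apply/matrixP => i j.
exact: is_deriveC_unique (dA i j) (dB i j).
Qed.

(** Once the inverse is known to have some derivative, differentiating [F t *m invmx (F t) = 1%:M]
    and uniqueness of derivatives determine its value. *)
Lemma is_mxderiveC_inv F s A : (forall t, F t \in unitmx) ->
  is_mxderiveC F s A ->
  is_mxderiveC (fun t => invmx (F t)) s (- (invmx (F s) *m A *m invmx (F s))).
Proof.
move=> Fu dF; have /is_mxderiveCP dF' := dF.
have [D dD] : exists D, is_mxderiveC (fun t => invmx (F t)) s D.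
  have /choice[D0 hD0] : forall p : 'I_N * 'I_N,
      derivableC (fun t => invmx (F t) p.1 p.2) s.
    by move=> [i j]; apply: derivableC_invmx => // k l; exists (A k l).
  exists (\matrix_(i, j) D0 (i, j)); apply/is_mxderiveCP => i j.
  by rewrite mxE; exact: (hD0 (i, j)).
suff -> : - (invmx (F s) *m A *m invmx (F s)) = D by [].
have d1 := is_mxderiveC_mul dF dD.
have d0 := is_mxderiveC_cst (1%:M : 'M[C]_N) s.
have e : (fun t => F t *m invmx (F t)) = fun=> 1%:M.
  by apply/funext => t; rewrite mulmxV.
rewrite e in d1; have /eqP := is_mxderiveC_unique d1 d0.
rewrite addr_eq0 => /eqP FD.
by rewrite -mulmxA -mulmxN -FD mulKmx.
Qed.

Lemma is_mxderive_lfun (f : 'End('M[R]_N)) (F : R -> 'M[R]_N) s D :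
  is_mxderive F s D -> is_mxderive (fun t => f (F t)) s (f D).
Proof.
move=> dF i j.
have fE A : f A i j = \sum_(p : 'I_N * 'I_N) A p.1 p.2 * f (delta_mx p.1 p.2) i j.
  rewrite {1}[A]matrix_sum_delta pair_big /= linear_sum summxE.
  by apply: eq_bigr => p _; rewrite linearZ mxE.
under eq_fun do rewrite fE; rewrite fE; apply: is_derive_sumf => p.
apply: (is_derive_valE (is_derive_mulf (dF p.1 p.2)
  (is_derive_constf s (f (delta_mx p.1 p.2) i j)))).
by rewrite mulr0 add0r.
Qed.

End MatrixDerive.

(** * Entrywise limits of complex matrices along a filter *)

Section Limits.
Context (l : set_system R) {Fl : ProperFilter l}.

Definition cvgC f (z : C) :=
  ((fun t => complex.Re (f t)) @ l --> complex.Re z) /\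
  ((fun t => complex.Im (f t)) @ l --> complex.Im z).

Lemma cvgC_cst z : cvgC (fun=> z) z.
Proof. by split; apply: cvg_cst. Qed.

Lemma cvgC_add f g a b : cvgC f a -> cvgC g b -> cvgC (fun t => f t + g t) (a + b).
Proof.
move=> [fr fi] [gr gi]; rewrite /cvgC ReD ImD.
under eq_fun do rewrite ReD; under [X in _ /\ (X @ _ --> _)]eq_fun do rewrite ImD.
by split; apply: cvgD.
Qed.

Lemma cvgC_mul f g a b : cvgC f a -> cvgC g b -> cvgC (fun t => f t * g t) (a * b).
Proof.
move=> [fr fi] [gr gi]; rewrite /cvgC ReM ImM.
under eq_fun do rewrite ReM; under [X in _ /\ (X @ _ --> _)]eq_fun do rewrite ImM.
by split; [apply: cvgB | apply: cvgD]; apply: cvgM.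
Qed.

Lemma cvgC_sum (I : finType) (f : I -> R -> C) (a : I -> C) :
  (forall i, cvgC (f i) (a i)) -> cvgC (fun t => \sum_i f i t) (\sum_i a i).
Proof.
move=> fa; elim: (index_enum I) => [|i r ih].
  by rewrite big_nil; under eq_fun do rewrite big_nil; exact: cvgC_cst.
by rewrite big_cons; under eq_fun do rewrite big_cons; exact: cvgC_add.
Qed.

Lemma cvgC_unique f a b : cvgC f a -> cvgC f b -> a = b.
Proof.
move=> [ar ai] [br bi]; apply: complex_ext.
  exact: (cvg_unique _ ar br).
exact: (cvg_unique _ ai bi).
Qed.

Definition mxcvgC m n (F : R -> 'M[C]_(m, n)) (Z : 'M[C]_(m, n)) :=
  forall i j, cvgC (fun t => F t i j) (Z i j).

Lemma mxcvgC_cst m n (Z : 'M[C]_(m, n)) : mxcvgC (fun=> Z) Z.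
Proof. by move=> i j; apply: cvgC_cst. Qed.

Lemma mxcvgC_mul m n p (F : R -> 'M[C]_(m, n)) (H : R -> 'M[C]_(n, p)) Z W :
  mxcvgC F Z -> mxcvgC H W -> mxcvgC (fun t => F t *m H t) (Z *m W).
Proof.
move=> FZ HW i j; rewrite mxE; under eq_fun do rewrite mxE.
by apply: cvgC_sum => k; apply: cvgC_mul.
Qed.

Lemma mxcvgC_unique m n (F : R -> 'M[C]_(m, n)) Z W :
  mxcvgC F Z -> mxcvgC F W -> Z = W.
Proof. by move=> FZ FW; apply/matrixP => i j; apply: cvgC_unique (FZ i j) (FW i j). Qed.

Lemma mx_limCE n (F : R -> 'M[C]_n) Z : mxcvgC F Z -> mx_limC l F = Z.
Proof.
move=> FZ; apply/matrixP => i j; rewrite mxE; have [zr zi] := FZ i j.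
by rewrite (cvg_lim _ zr) // (cvg_lim _ zi) //; case: (Z i j).
Qed.

Lemma mxcvg_lfun N (f : 'End('M[R]_N)) (F : R -> 'M[R]_N) (Z : 'M[R]_N) :
  (forall i j, (fun t => F t i j) @ l --> Z i j) ->
  forall i j, (fun t => f (F t) i j) @ l --> f Z i j.
Proof.
move=> FZ i j.
have fE A : f A i j = \sum_(p : 'I_N * 'I_N) A p.1 p.2 * f (delta_mx p.1 p.2) i j.
  rewrite {1}[A]matrix_sum_delta pair_big /= linear_sum summxE.
  by apply: eq_bigr => p _; rewrite linearZ mxE.
under eq_fun do rewrite fE; rewrite fE.
elim: (index_enum _) => [|p r ih].
  by under [X in X @ _]eq_fun do rewrite big_nil; rewrite big_nil; exact: cvg_cst.
under [X in X @ _]eq_fun do rewrite big_cons; rewrite big_cons; apply: cvgD => //.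
by apply: cvgMl; exact: FZ.
Qed.

(** Subspaces are closed: [L] is the kernel of the linear map [\1 - projv L], through which limits
    pass. *)
Lemma memC_cvg N (L : {vspace 'M[R]_N}) (F : R -> 'M[C]_N) Z :
  mxcvgC F Z -> (forall t, memC L (F t)) -> memC L Z.
Proof.
move=> FZ FL; pose f : 'End('M[R]_N) := (\1 - projv L)%VF.
have fP A : (A \in L) = (f A == 0).
  rewrite /f add_lfunE opp_lfunE id_lfunE subr_eq0; apply/idP/eqP => [AL|->].
    by rewrite projv_id.
  exact: memv_proj.
have real_case (G : R -> 'M[R]_N) (A : 'M[R]_N) : (forall i j, (fun t => G t i j) @ l --> A i j) ->
    (forall t, G t \in L) -> A \in L.
  move=> GA GL; rewrite fP; apply/eqP/matrixP => i j; rewrite mxE.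
  have : (fun t => f (G t) i j) @ l --> f A i j.
    by have := @mxcvg_lfun N f G A GA; apply.
  have -> : (fun t => f (G t) i j) = fun=> 0.
    by apply/funext => t; have := GL t; rewrite fP => /eqP ->; rewrite mxE.
  have h0 : (fun=> 0 : R) @ l --> (0 : R) by apply: cvg_cst.
  by move=> h; exact: (cvg_unique _ h h0).
split.
  apply: (real_case (fun t => mxRe (F t))) => [i j|t]; last by have [] := FL t.
  by rewrite mxE; under eq_fun do rewrite mxE; have [] := FZ i j.
apply: (real_case (fun t => mxIm (F t))) => [i j|t]; last by have [] := FL t.
by rewrite mxE; under eq_fun do rewrite mxE; have [] := FZ i j.
Qed.

End Limits.

End ComplexCalculus.

(** * Path-ordered exponentials *)

Section MatrixNorm.
Variable R : realType.
Local Notation C := R[i].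

(** The entrywise l1 norm is submultiplicative and, summed over real and imaginary parts, is exactly
    the sum of absolute values in the Gronwall hypothesis. *)
Definition norm1 m n (A : 'M[R]_(m, n)) : R := \sum_i \sum_j `|A i j|.
Definition normC1 m n (Z : 'M[C]_(m, n)) : R := norm1 (mxRe Z) + norm1 (mxIm Z).

Lemma norm1_ge0 m n (A : 'M[R]_(m, n)) : 0 <= norm1 A.
Proof. by apply: sumr_ge0 => i _; apply: sumr_ge0. Qed.

Lemma norm1D m n (A B : 'M[R]_(m, n)) : norm1 (A + B) <= norm1 A + norm1 B.
Proof.
rewrite -big_split; apply: ler_sum => i _; rewrite -big_split; apply: ler_sum => j _.
by rewrite mxE ler_normD.
Qed.

Lemma norm1N m n (A : 'M[R]_(m, n)) : norm1 (- A) = norm1 A.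
Proof. by apply: eq_bigr => i _; apply: eq_bigr => j _; rewrite mxE normrN. Qed.

Lemma norm1_entry m n (A : 'M[R]_(m, n)) i j : `|A i j| <= norm1 A.
Proof.
rewrite /norm1 (bigD1 i) //= (bigD1 j) //= -addrA lerDl addr_ge0 ?sumr_ge0 // => k _.
by rewrite sumr_ge0.
Qed.

Lemma norm1M m n p (A : 'M[R]_(m, n)) (B : 'M[R]_(n, p)) :
  norm1 (A *m B) <= norm1 A * norm1 B.
Proof.
rewrite /norm1 mulr_suml; apply: ler_sum => i _; rewrite mulr_suml.
apply: (@le_trans _ _ (\sum_j \sum_k `|A i k| * `|B k j|)).
  apply: ler_sum => j _; rewrite mxE; apply: le_trans (ler_norm_sum _ _ _) _.
  by apply: ler_sum => k _; rewrite normrM.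
rewrite exchange_big; apply: ler_sum => k _ /=.
rewrite -mulr_sumr; apply: ler_wpM2l => //.
by rewrite [leRHS](bigD1 k) //= lerDl sumr_ge0 // => l _; rewrite sumr_ge0.
Qed.

Lemma normC1_ge0 m n (Z : 'M[C]_(m, n)) : 0 <= normC1 Z.
Proof. by rewrite addr_ge0 ?norm1_ge0. Qed.

Lemma normC1D m n (Z W : 'M[C]_(m, n)) : normC1 (Z + W) <= normC1 Z + normC1 W.
Proof.
rewrite /normC1 mxReD mxImD addrACA.
by apply: lerD; exact: norm1D.
Qed.

Lemma normC1N m n (Z : 'M[C]_(m, n)) : normC1 (- Z) = normC1 Z.
Proof.
rewrite /normC1 -scaleN1r mxReZ mxImZ /= oppr0 !scale0r subr0 addr0 !scaleN1r.
by rewrite !norm1N.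
Qed.

Lemma normC1M m n p (Z : 'M[C]_(m, n)) (W : 'M[C]_(n, p)) :
  normC1 (Z *m W) <= normC1 Z * normC1 W.
Proof.
rewrite /normC1 mxReM mxImM.
have := norm1D (mxRe Z *m mxRe W) (- (mxIm Z *m mxIm W)); rewrite norm1N.
have := norm1D (mxRe Z *m mxIm W) (mxIm Z *m mxRe W).
have := norm1M (mxRe Z) (mxRe W); have := norm1M (mxIm Z) (mxIm W).
have := norm1M (mxRe Z) (mxIm W); have := norm1M (mxIm Z) (mxRe W).
lra.
Qed.

Lemma norm1_lfun N (f : 'End('M[R]_N)) :
  exists2 K, 0 <= K & forall A, norm1 (f A) <= K * norm1 A.
Proof.
exists (\sum_i \sum_j \sum_(p : 'I_N * 'I_N) `|f (delta_mx p.1 p.2) i j|).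
  by do 3![apply: sumr_ge0 => ? _].
move=> A; rewrite mulr_suml; apply: ler_sum => i _; rewrite mulr_suml.
apply: ler_sum => j _; rewrite {1}[A]matrix_sum_delta pair_big /= linear_sum summxE.
apply: le_trans (ler_norm_sum _ _ _) _; rewrite mulr_suml; apply: ler_sum => p _.
by rewrite linearZ mxE normrM mulrC; apply: ler_wpM2l => //; apply: norm1_entry.
Qed.

Lemma normC1_lfun N (f : 'End('M[R]_N)) :
  exists2 K, 0 <= K & forall Z,
    normC1 (cplx (f (mxRe Z)) (f (mxIm Z))) <= K * normC1 Z.
Proof.
have [K K0 fK] := norm1_lfun f; exists K => // Z.
by rewrite /normC1 !mxCK mulrDr; apply: lerD.
Qed.

End MatrixNorm.

Section MatrixGronwall.
Variables (R : realType) (N : nat) (alpha Phi : R -> R).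
Local Notation MC := ('M[R[i]]_N).
Variables (Y dY : R -> MC).
Hypothesis alpha_ge0 : forall s, 0 <= alpha s.
Hypothesis dPhi : forall s, is_derive s (1 : R) Phi (alpha s).
Hypothesis dYE : forall s, is_mxderiveC Y s (dY s).
Hypothesis dY_le : forall s, normC1 (dY s) <= alpha s * normC1 (Y s).

(** A complex matrix is flattened into a finite real family; the boolean selects the real ([true])
    or imaginary part. Matrix equations thus become instances of the estimates for families. *)
Let idx := (bool * ('I_N * 'I_N))%type.
Let comp (F : R -> MC) (p : idx) s : R :=
  if p.1 then complex.Re (F s p.2.1 p.2.2) else complex.Im (F s p.2.1 p.2.2).

Let comp_norm F s : \sum_p `|comp F p s| = normC1 (F s).
Proof.
rewrite -(pair_bigA _ (fun b q => `|comp F (b, q) s|)) /= big_bool /=.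
rewrite /normC1 /norm1 !pair_bigA /=.
by congr (_ + _); apply: eq_bigr => p _; rewrite mxE.
Qed.

Let dcomp p s : is_derive s (1 : R) (comp Y p) (comp dY p s).
Proof.
case: p => [[] [i j]]; have /is_mxderiveCP /(_ i j) [dr di] := dYE s.
  exact: dr.
exact: di.
Qed.

Let dcomp_le p s : `|comp dY p s| <= alpha s * \sum_q `|comp Y q s|.
Proof.
rewrite comp_norm; apply: le_trans (dY_le s); rewrite -comp_norm.
by rewrite (bigD1 p) //= lerDl sumr_ge0.
Qed.

Lemma mx_gronwall_eq0 s0 : Y s0 = 0 -> forall s, Y s = 0.
Proof.
move=> Y0 s; have h := gronwall_eq0 alpha_ge0 dPhi dcomp dcomp_le.
have {}h := h s0; apply/matrixP => i j; rewrite mxE; apply: complex_ext.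
  apply: (h _ (true, (i, j)) s) => -[[] [k l]]; rewrite /comp /= Y0 mxE //.
apply: (h _ (false, (i, j)) s) => -[[] [k l]]; rewrite /comp /= Y0 mxE //.
Qed.

Hypothesis Phi_bounded : exists B, forall s, `|Phi s| <= B.

Lemma mx_gronwall_bounded : exists K, forall i j s,
  `|complex.Re (Y s i j)| <= K /\ `|complex.Im (Y s i j)| <= K.
Proof.
have [K YK] := gronwall_bounded alpha_ge0 dPhi dcomp dcomp_le Phi_bounded.
by exists K => i j s; split; [exact: (YK (true, (i, j)) s) | exact: (YK (false, (i, j)) s)].
Qed.

Lemma mx_gronwall_cvg :
  (exists Z, mxcvgC (+oo : set_system R) Y Z) /\
  (exists Z, mxcvgC (-oo : set_system R) Y Z).
Proof.
have h := gronwall_cvg alpha_ge0 dPhi dcomp dcomp_le Phi_bounded.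
have /choice[lp hp] p := (h p).1; have /choice[lm hm] p := (h p).2.
split.
  exists (\matrix_(i, j) Complex (lp (true, (i, j))) (lp (false, (i, j)))).
  move=> i j; rewrite mxE; split.
    exact: (hp (true, (i, j))).
  exact: (hp (false, (i, j))).
exists (\matrix_(i, j) Complex (lm (true, (i, j))) (lm (false, (i, j)))).
move=> i j; rewrite mxE; split.
  exact: (hm (true, (i, j))).
exact: (hm (false, (i, j))).
Qed.

End MatrixGronwall.

(** * Closure properties of bounded continuous functions *)

Section TestFunctions.
Variable R : realType.
Implicit Types f g : R -> R.

Lemma test_functionP f :
  test_function f <-> continuous f /\ exists K, forall s, `|f s| <= K.
Proof.
split=> [[fc [M [_ fM]]]|[fc [K fK]]]; split=> //.
  by exists (M + 1) => s; apply: fM => //; rewrite ltrDl.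
exists K; split; first exact: num_real.
by move=> x Kx s _; apply: le_trans (fK s) (ltW Kx).
Qed.

Lemma test_function_add f g : test_function f -> test_function g ->
  test_function (fun s => f s + g s).
Proof.
move=> /test_functionP[fc [K fK]] /test_functionP[gc [K' gK]]; apply/test_functionP.
split; first by move=> s; apply: cvgD; [exact: fc | exact: gc].
by exists (K + K') => s; apply: le_trans (ler_normD _ _) _; apply: lerD.
Qed.

Lemma test_function_mul f g : test_function f -> test_function g ->
  test_function (fun s => f s * g s).
Proof.
move=> /test_functionP[fc [K fK]] /test_functionP[gc [K' gK]]; apply/test_functionP.
split; first by move=> s; apply: cvgM; [exact: fc | exact: gc].
by exists (K * K') => s; rewrite normrM; apply: ler_pM.
Qed.

Lemma test_function_cst (c : R) : test_function (fun=> c).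
Proof. by apply/test_functionP; split; [exact: cst_continuous | exists `|c|]. Qed.

Lemma test_function_sub f g : test_function f -> test_function g ->
  test_function (fun s => f s - g s).
Proof.
move=> hf hg; have := test_function_add hf (test_function_mul (test_function_cst (-1)) hg).
by under eq_fun do rewrite mulN1r.
Qed.

Definition test_functionC (f : R -> R[i]) :=
  test_function (fun s => complex.Re (f s)) /\ test_function (fun s => complex.Im (f s)).

Lemma test_functionC_mul (f g : R -> R[i]) :
  test_functionC f -> test_functionC g -> test_functionC (fun s => f s * g s).
Proof.
move=> [fr fi] [gr gi]; rewrite /test_functionC.
under eq_fun do rewrite ReM; under [X in _ /\ test_function X]eq_fun do rewrite ImM.
by split; [apply: test_function_sub | apply: test_function_add]; apply: test_function_mul.
Qed.

Lemma test_functionC_cst (c : R[i]) : test_functionC (fun=> c).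
Proof. by split; apply: test_function_cst. Qed.

Lemma test_functionC_sum (I : Type) (r : seq I) (f : I -> R -> R[i]) :
  (forall i, test_functionC (f i)) -> test_functionC (fun s => \sum_(i <- r) f i s).
Proof.
move=> fT; elim: r => [|i r [hr hi]].
  by under eq_fun do rewrite big_nil; exact: test_functionC_cst.
under eq_fun do rewrite big_cons; rewrite /test_functionC.
under eq_fun do rewrite ReD; under [X in _ /\ test_function X]eq_fun do rewrite ImD.
by have [? ?] := fT i; split; apply: test_function_add.
Qed.

Definition test_functionM m n (Y : R -> 'M[R[i]]_(m, n)) :=
  forall i j, test_functionC (fun s => Y s i j).

Lemma test_functionM_mul m n p (Y : R -> 'M[R[i]]_(m, n)) (Z : R -> 'M[R[i]]_(n, p)) :
  test_functionM Y -> test_functionM Z -> test_functionM (fun s => Y s *m Z s).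
Proof.
move=> YT ZT i j; under eq_fun do rewrite mxE.
by apply: test_functionC_sum => k; apply: test_functionC_mul.
Qed.

Lemma test_functionM_cst m n (Z : 'M[R[i]]_(m, n)) : test_functionM (fun=> Z).
Proof. by move=> i j; apply: test_functionC_cst. Qed.

Lemma is_mxderiveC_test N (Y dY : R -> 'M[R[i]]_N) :
  (forall s, is_mxderiveC Y s (dY s)) ->
  (exists K, forall i j s,
    `|complex.Re (Y s i j)| <= K /\ `|complex.Im (Y s i j)| <= K) ->
  test_functionM Y.
Proof.
move=> dYE [K YK] i j; have {}dYE s := iffLR (is_mxderiveCP _ _ _) (dYE s) i j.
split; apply/test_functionP; split.
- by apply: is_derive_continuous => s; have [] := dYE s.
- by exists K => s; have [] := YK i j s.
- by apply: is_derive_continuous => s; have [] := dYE s.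
- by exists K => s; have [] := YK i j s.
Qed.

End TestFunctions.

Section PathOrderedExp.
Variables (R : realType) (N : nat).
Local Notation MC := ('M[R[i]]_N).
Variables (A : R -> MC) (U : R -> R -> MC) (alpha Phi : R -> R).
Hypothesis AU : path_ordered_exp A U.
Hypothesis alpha_ge0 : forall s, 0 <= alpha s.
Hypothesis A_le : forall s, normC1 (A s) <= alpha s.
Hypothesis dPhi : forall s, is_derive s (1 : R) Phi (alpha s).
Hypothesis Phi_bounded : exists B, forall s, `|Phi s| <= B.

Lemma path_exp_id s : U s s = 1%:M. Proof. by case: AU. Qed.

Lemma path_exp_unit s s' : U s s' \in unitmx. Proof. by case: AU. Qed.

Lemma path_exp_derive s s' :
  is_mxderiveC (fun t => U t s') s (- (A s *m U s s')).
Proof.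
case: AU => _ _ /(_ s s')[D [dD DU]].
by rewrite -mulNmx -DU mulmxKV ?path_exp_unit.
Qed.

Let bound_left (Y : R -> MC) s : normC1 (- (A s *m Y s)) <= alpha s * normC1 (Y s).
Proof.
rewrite normC1N; apply: le_trans (normC1M _ _) _.
by apply: ler_wpM2r; rewrite ?normC1_ge0.
Qed.

(** As functions of the first endpoint, both sides solve the same linear equation and agree at [s'];
    their difference [Y] vanishes by Gronwall. *)
Lemma path_exp_comp s s' s'' : U s s'' = U s s' *m U s' s''.
Proof.
pose Y t := U t s'' + - U t s' *m U s' s''.
suff : Y s = 0 by rewrite /Y mulNmx => /eqP; rewrite subr_eq0 => /eqP.
have dY t : is_mxderiveC Y t (- (A t *m Y t)).
  have dU := is_mxderiveC_mul (is_mxderiveC_mul (is_mxderiveC_cst (- 1%:M) t)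
    (path_exp_derive t s')) (is_mxderiveC_cst (U s' s'') t).
  have := is_mxderiveC_add (path_exp_derive t s'') dU.
  rewrite mulmx0 add0r mul0mx addr0.
  have -> : (fun t => U t s'' + (- 1%:M *m U t s') *m U s' s'') = Y.
    by apply/funext => u; rewrite mulNmx mul1mx.
  suff -> : - (A t *m U t s'') + (- 1%:M *m - (A t *m U t s')) *m U s' s'' =
    - (A t *m Y t) by [].
  by rewrite mulNmx mul1mx opprK /Y mulmxDr opprD !mulNmx mulmxN opprK mulmxA.
apply: (mx_gronwall_eq0 alpha_ge0 dPhi dY (bound_left Y) (s0 := s')).
by rewrite /Y path_exp_id mulNmx mul1mx subrr.
Qed.

Lemma path_exp_mulV s s' : U s s' *m U s' s = 1%:M.
Proof. by rewrite -path_exp_comp path_exp_id. Qed.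

Lemma path_exp_inv s s' : invmx (U s s') = U s' s.
Proof.
by rewrite -[RHS]mul1mx -(mulVmx (path_exp_unit s s')) -mulmxA path_exp_mulV mulmx1.
Qed.

(** By the composition law, [U s'] is the inverse of [U^~ s'], whose derivative is known, so the
    rule for inverses applies. *)
Lemma path_exp_derive_right s s' : is_mxderiveC (fun t => U s' t) s (U s' s *m A s).
Proof.
have := is_mxderiveC_inv (path_exp_unit^~ s') (path_exp_derive s s').
have -> : (fun t => invmx (U t s')) = U s' by apply/funext => t; rewrite path_exp_inv.
by rewrite path_exp_inv mulmxN mulNmx opprK mulmxA -mulmxA path_exp_mulV mulmx1.
Qed.

Let bound_right (Y : R -> MC) s : normC1 (Y s *m A s) <= alpha s * normC1 (Y s).
Proof.
apply: le_trans (normC1M _ _) _; rewrite mulrC.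
by apply: ler_wpM2r; rewrite ?normC1_ge0.
Qed.

Lemma path_exp_left_test s' : test_functionM (U^~ s').
Proof.
apply: (is_mxderiveC_test (path_exp_derive^~ s')).
exact: (mx_gronwall_bounded alpha_ge0 dPhi (path_exp_derive^~ s') (bound_left _)).
Qed.

Lemma path_exp_right_test s' : test_functionM (U s').
Proof.
apply: (is_mxderiveC_test (path_exp_derive_right^~ s')).
exact: (mx_gronwall_bounded alpha_ge0 dPhi (path_exp_derive_right^~ s') (bound_right _)).
Qed.

(* Up, Um, Vp, Vm stand for U(+oo, 0), U(-oo, 0), U(0, +oo), U(0, -oo). *)
Lemma path_exp_asymptotics : exists Up Um Vp Vm : MC,
  [/\ mxcvgC (-oo : set_system R) (U^~ 0) Um, mxcvgC (-oo : set_system R) (U 0) Vm,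
      Up *m Vp = 1%:M, Um *m Vm = 1%:M &
   [/\ forall s, from_minfty U s = U s 0 *m Vm,
      forall s, to_pinfty U s = Up *m U 0 s &
      whole_line U = Up *m Vm]].
Proof.
have [[Up hUp] [Um hUm]] := mx_gronwall_cvg alpha_ge0 dPhi
  (path_exp_derive^~ 0) (bound_left _) Phi_bounded.
have [[Vp hVp] [Vm hVm]] := mx_gronwall_cvg alpha_ge0 dPhi
  (path_exp_derive_right^~ 0) (bound_right _) Phi_bounded.
(* Both factors converge separately, so this identity survives in the limit; each limit is
   invertible because the limit of the inverses is its inverse. *)
have eq1 : (fun t => U t 0 *m U 0 t) = fun=> 1%:M.
  by apply/funext => t; rewrite path_exp_mulV.
have fromE s : from_minfty U s = U s 0 *m Vm.
  rewrite -(mx_limCE (mxcvgC_mul (mxcvgC_cst (U s 0)) hVm)) /from_minfty.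
  by congr mx_limC; apply/funext => t; rewrite -path_exp_comp.
exists Up, Um, Vp, Vm; split => //.
- have h : mxcvgC (+oo : set_system R) (fun=> 1%:M) (Up *m Vp).
    by rewrite -eq1; exact (mxcvgC_mul hUp hVp).
  exact: (mxcvgC_unique h (mxcvgC_cst 1%:M)).
- have h : mxcvgC (-oo : set_system R) (fun=> 1%:M) (Um *m Vm).
    by rewrite -eq1; exact (mxcvgC_mul hUm hVm).
  exact: (mxcvgC_unique h (mxcvgC_cst 1%:M)).
split=> // [s|].
  rewrite -(mx_limCE (mxcvgC_mul hUp (mxcvgC_cst (U 0 s)))) /to_pinfty.
  by congr mx_limC; apply/funext => t; rewrite -path_exp_comp.
rewrite /whole_line (_ : from_minfty U = fun t => U t 0 *m Vm); last exact/funext.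
exact: (mx_limCE (mxcvgC_mul hUp (mxcvgC_cst Vm))).
Qed.

(** The facts needed for the bracket: factoring the whole-line operator at [s] leaves only the
    inverse of [from_minfty U s], and both half-line operators are admissible as test functions. *)
Lemma path_exp_minfty s :
  [/\ from_minfty U s \in unitmx,
      invmx (whole_line U) *m to_pinfty U s = invmx (from_minfty U s),
      test_functionM (from_minfty U) & test_functionM (to_pinfty U)].
Proof.
have [Up [Um [Vp [Vm [_ _ UVp UVm [fromE toE wholeE]]]]]] := path_exp_asymptotics.
have [Upu _] := mulmx1_unit UVp; have [_ Vmu] := mulmx1_unit UVm.
have Vu : from_minfty U s \in unitmx by rewrite fromE unitmx_mul path_exp_unit.
split=> //.
- have wu : whole_line U \in unitmx by rewrite wholeE unitmx_mul Upu.
  apply: (can_inj (mulKmx wu)); rewrite mulKVmx // wholeE toE.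
  apply: (can_inj (mulmxK Vu)); rewrite mulmxKV // fromE.
  by rewrite !mulmxA -[_ *m U 0 s *m _]mulmxA path_exp_mulV mulmx1.
- have -> : from_minfty U = fun t => U t 0 *m Vm by exact/funext.
  exact: (test_functionM_mul (path_exp_left_test 0) (test_functionM_cst Vm)).
- have -> : to_pinfty U = fun t => Up *m U 0 t by exact/funext.
  exact: (test_functionM_mul (test_functionM_cst Up) (path_exp_right_test 0)).
Qed.

Section Adjoint.
Variable L : {vspace 'M[R]_N}.
Hypothesis hL : lie_subalgebra L.
Hypothesis AL : forall s, memC L (A s).

(* The component of Y(t) = U(t,s') Z U(s',t) transverse to L^C solves a linear
   equation with vanishing initial value, because [L^C, A] lies in L^C. *)
Lemma path_exp_Ad t s' Z : memC L Z -> memC L (U t s' *m Z *m U s' t).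
Proof.
move=> ZL; pose Y u := U u s' *m Z *m U s' u.
have dY u : is_mxderiveC Y u (lie (Y u) (A u)).
  have := is_mxderiveC_mul (is_mxderiveC_mul (path_exp_derive u s')
    (is_mxderiveC_cst Z u)) (path_exp_derive_right u s').
  rewrite mulmx0 add0r; congr is_mxderiveC.
  by rewrite /lie /Y !mulNmx !mulmxA.
(* The complementary projection has kernel [L], so the claim becomes the vanishing of [fC (Y t)]. *)
pose f : 'End('M[R]_N) := (\1 - projv L)%VF.
pose fC W : MC := cplx (f (mxRe W)) (f (mxIm W)).
have fP B : (B \in L) = (f B == 0).
  rewrite /f add_lfunE opp_lfunE id_lfunE subr_eq0; apply/idP/eqP => [BL|->].
    by rewrite projv_id.
  exact: memv_proj.
have fCP W : memC L W <-> fC W = 0.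
  split=> [[WR WI]|W0].
    move: WR WI; rewrite !fP /fC => /eqP -> /eqP ->.
    by apply/matrixP => i j; rewrite !mxE.
  have := congr1 (@mxRe R N N) W0; have := congr1 (@mxIm R N N) W0.
  rewrite !mxCK => W1 W2; split; rewrite fP.
    by rewrite W2; apply/eqP/matrixP => i j; rewrite !mxE.
  by rewrite W1; apply/eqP/matrixP => i j; rewrite !mxE.
have fCD W W' : fC (W + W') = fC W + fC W'.
  by apply: cplx_inj; rewrite ?mxReD ?mxImD !mxCK ?mxReD ?mxImD linearD.
have fC_compl W : memC L (W - fC W).
  split; rewrite -scaleN1r ?mxReD ?mxImD ?mxReZ ?mxImZ !mxCK /= oppr0 scale0r ?subr0 ?addr0.
    by rewrite scaleN1r /f add_lfunE opp_lfunE id_lfunE subKr memv_proj.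
  by rewrite scaleN1r /f add_lfunE opp_lfunE id_lfunE subKr memv_proj.
(* [Y u - fC (Y u)] lies in the complexified algebra, hence so does its bracket with [A u], and [fC]
   kills it: the equation for the transverse component closes on itself. *)
have fC_lie u : fC (lie (Y u) (A u)) = fC (lie (fC (Y u)) (A u)).
  have -> : lie (Y u) (A u) = lie (Y u - fC (Y u)) (A u) + lie (fC (Y u)) (A u).
    by have := lie_linearl 1 (Y u - fC (Y u)) (fC (Y u)) (A u); rewrite !scale1r subrK.
  rewrite fCD (iffLR (fCP _)) ?add0r //.
  exact: (memC_lie hL).
have [K K0 fK] := normC1_lfun f.
(* The factor 2 counts the terms of the commutator, and [K] bounds the projection [f]. *)
pose beta u := 2 * K * alpha u; pose Psi u := 2 * K * Phi u.
have beta_ge0 u : 0 <= beta u by rewrite !mulr_ge0.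
have dPsi u : is_derive u (1 : R) Psi (beta u).
  apply: (is_derive_valE (is_derive_mulf (is_derive_constf u (2 * K)) (dPhi u))).
  by rewrite mul0r addr0.
have dfY u : is_mxderiveC (fun v => fC (Y v)) u (fC (lie (Y u) (A u))).
  have [dr di] := dY u; split; rewrite mxCK.
    rewrite (_ : (fun v => _) = fun v => f (mxRe (Y v))); first exact: is_mxderive_lfun.
    by apply/funext => v; rewrite mxCK.
  rewrite (_ : (fun v => _) = fun v => f (mxIm (Y v))); first exact: is_mxderive_lfun.
  by apply/funext => v; rewrite mxCK.
have fY_le u : normC1 (fC (lie (Y u) (A u))) <= beta u * normC1 (fC (Y u)).
  rewrite fC_lie; apply: le_trans (fK _) _.
  have := normC1D (fC (Y u) *m A u) (- (A u *m fC (Y u))); rewrite normC1N -/(lie _ _).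
  have := normC1M (fC (Y u)) (A u); have := normC1M (A u) (fC (Y u)).
  have := A_le u; have := normC1_ge0 (fC (Y u)); rewrite /beta.
  set x := normC1 (fC (Y u)); set y := normC1 (A u) => x0 yA h1 h2 h3.
  have h : normC1 (lie (fC (Y u)) (A u)) <= 2 * alpha u * x by nra.
  have -> : 2 * K * alpha u * x = K * (2 * alpha u * x) by ring.
  exact: ler_wpM2l.
apply/fCP; apply: (mx_gronwall_eq0 beta_ge0 dPsi dfY fY_le (s0 := s')).
by apply/fCP; rewrite /Y path_exp_id mul1mx mulmx1.
Qed.

(** The inverse of U(s, -oo) is the limit of the U(t, s), so both conjugations are limits of
    conjugations between finite endpoints, under which the complexified algebra is invariant and in
    which it is closed. *)
Lemma from_minfty_Ad s Z : memC L Z ->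
  memC L (from_minfty U s *m Z *m invmx (from_minfty U s)) /\
  memC L (invmx (from_minfty U s) *m Z *m from_minfty U s).
Proof.
have [Up [Um [Vp [Vm [hUm hVm _ UVm [fromE _ _]]]]]] := path_exp_asymptotics.
have [Vu _ _ _] := path_exp_minfty s.
have -> : invmx (from_minfty U s) = Um *m U 0 s.
  apply: (can_inj (mulKmx Vu)); rewrite mulmxV // fromE mulmxA.
  by rewrite -[_ *m Vm *m Um]mulmxA (mulmx1C UVm) mulmx1 path_exp_mulV.
move=> ZL; rewrite fromE; split.
  have VL : memC L (Vm *m Z *m Um).
    apply: (@memC_cvg _ (-oo : set_system R) _ _ _ (fun t => U 0 t *m Z *m U t 0)) => [|t].
      exact: (mxcvgC_mul (mxcvgC_mul hVm (mxcvgC_cst Z)) hUm).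
    exact: path_exp_Ad.
  by have := path_exp_Ad s 0 VL; rewrite !mulmxA.
have := path_exp_Ad 0 s ZL; set W := (X in memC L X) => WL.
  have -> : Um *m U 0 s *m Z *m (U s 0 *m Vm) = Um *m W *m Vm by rewrite !mulmxA.
  apply: (@memC_cvg _ (-oo : set_system R) _ _ _ (fun t => U t 0 *m W *m U 0 t)) => [|t].
    exact: (mxcvgC_mul (mxcvgC_mul hUm (mxcvgC_cst W)) hVm).
  exact: path_exp_Ad.
Qed.

End Adjoint.

End PathOrderedExp.

(** * Brackets of smeared fields *)

Section Integrals.
Variable R : realType.
Local Notation mu := (@lebesgue_measure R).

Lemma Rintegral_sumf (I : Type) (r : seq I) (F : I -> R -> R) :
  (forall i, mu.-integrable setT (EFin \o F i)) ->
  mu.-integrable setT (EFin \o (fun s => \sum_(i <- r) F i s)) /\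
  Rintegral mu setT (fun s => \sum_(i <- r) F i s) =
  \sum_(i <- r) Rintegral mu setT (F i).
Proof.
move=> FI; elim: r => [|i r [hr ih]].
  under eq_fun do rewrite big_nil.
  rewrite big_nil; split; first exact: integrable0.
  by rewrite /Rintegral integral0.
under eq_fun do rewrite big_cons; rewrite big_cons; split.
  by have := integrableD measurableT (FI i) hr.
by rewrite RintegralD // ih.
Qed.

Lemma integrable_test (phi f : R -> R) : test_function phi ->
  mu.-integrable setT (EFin \o f) ->
  mu.-integrable setT (EFin \o (fun s => phi s * f s)).
Proof.
move=> [phic phib] fI.
have -> : EFin \o (fun s => phi s * f s) = ((EFin \o phi) \* (EFin \o f))%E by [].
apply: (integrableMr measurableT) => //.
exact: continuous_measurable_fun.
Qed.

Lemma Rintegral_dirac (f : R -> R) (s : R) : continuous f ->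
  Rintegral (dirac (s : measurableTypeR R)) setT f = f s.
Proof.
move=> fc; have fm : measurable_fun setT (EFin \o f).
  by apply/measurable_EFinP; exact: continuous_measurable_fun.
have := integral_dirac (s : measurableTypeR R) measurableT fm.
by rewrite /Rintegral => ->; rewrite diracE in_setT mul1e.
Qed.

Lemma continuous_sumf (I : Type) (r : seq I) (F : I -> R -> R) :
  (forall i, continuous (F i)) -> continuous (fun s => \sum_(i <- r) F i s).
Proof.
move=> Fc; elim: r => [|i r ih].
  by under eq_fun do rewrite big_nil; exact: cst_continuous.
under eq_fun do rewrite big_cons; move=> s.
by apply: cvgD; [exact: Fc | exact: ih].
Qed.

Lemma continuous_mulf (f g : R -> R) : continuous f -> continuous g ->
  continuous (fun s => f s * g s).
Proof. by move=> fc gc s; apply: cvgM; [exact: fc | exact: gc]. Qed.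

Lemma continuous_subf (f g : R -> R) : continuous f -> continuous g ->
  continuous (fun s => f s - g s).
Proof. by move=> fc gc s; apply: cvgB; [exact: fc | exact: gc]. Qed.

End Integrals.

Section BracketSums.
Variables (R : realType) (M : Type) (P : poisson_bracket R M).
Variables (f h0 : M -> R[i]).
Hypothesis h0f : pbdef P h0 f.

Lemma pb_sum (I : Type) (r : seq I) (c : I -> R[i]) (F : I -> M -> R[i]) :
  (forall i, pbdef P (F i) f) ->
  pbdef P (fun m => \sum_(i <- r) c i * F i m) f /\
  forall m, P (fun m' => \sum_(i <- r) c i * F i m') f m =
            \sum_(i <- r) c i * P (F i) f m.
Proof.
move=> Ff; elim: r => [|i r [hr ih]].
  (* The bracket axioms do not mention the zero observable. It is written as [-1 * h0 + h0], where
     [h0] is any observable having a bracket with [f]. *)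
  have -> : (fun m => \sum_(i <- [::]) c i * F i m) = fun m => -1 * h0 m + h0 m.
    by apply/funext => m; rewrite big_nil mulN1r addNr.
  split=> [|m]; first exact: pbdef_lin.
  by rewrite pb_lin // big_nil mulN1r addNr.
have -> : (fun m => \sum_(j <- i :: r) c j * F j m) =
    fun m => c i * F i m + \sum_(j <- r) c j * F j m.
  by apply/funext => m; rewrite big_cons.
split=> [|m]; first exact: pbdef_lin.
by rewrite (pb_lin _ (Ff i) hr) big_cons ih.
Qed.

End BracketSums.

Section SmearedBrackets.
Variables (R : realType) (N : nat) (M : Type) (P : poisson_bracket R M).
Local Notation C := R[i].
Local Notation MC := ('M[C]_N).
Local Notation mu := (@lebesgue_measure R).

Lemma pb12_delta_entry (A B : M -> R -> 'M[R]_N) (D : M -> R -> 'M[R]_(N * N)) :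
  pb12_delta P A B D -> (forall m i j, continuous (fun s => D m s i j)) ->
  forall phi s k l p q, test_function phi ->
    pbdef P (fun m => smear A phi m k l) (fun m => at_pt B s m p q) /\
    forall m, P (fun m' => smear A phi m' k l) (fun m' => at_pt B s m' p q) m =
      (phi s * D m s (mxtens_index (k, p)) (mxtens_index (l, q)))%:C%C.
Proof.
move=> AB Dc phi s k l p q phiT; have [ABdef ABE] := AB phi s phiT.
split=> [|m]; first exact: ABdef.
have := congr1 (fun Z : 'M[C]_(N * N) => Z (mxtens_index (k, p)) (mxtens_index (l, q))) (ABE m).
rewrite !mxE !mxtens_indexK /= => ->.
congr Complex; under eq_fun do rewrite mxE.
rewrite Rintegral_dirac //; apply: continuous_mulf; last exact: Dc.
by case: phiT.
Qed.

Variables (r : 'End('M[R]_N)) (gamma : R) (e : bool).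

(** The expansion is over matrix units, not over a basis of [L], because the smeared brackets are
    given entry by entry; it makes sense since [r] is defined on all matrices. *)
Lemma mulmx_Rpm_expand (W V : MC) (B : 'M[R]_N) i j :
  (W *m Rpm r e (mxC B) *m V) i j = \sum_(q : 'I_N * 'I_N)
    (B q.1 q.2)%:C%C * (W *m Rpm r e (delta_mx q.1 q.2) *m V) i j.
Proof.
pose F (Z : MC) := (W *m Rpm r e Z *m V) i j.
have FE c Z Y : F (c *: Z + Y) = c * F Z + F Y.
  by rewrite /F Rpm_linear mulmxDr mulmxDl -scalemxAr -scalemxAl !mxE.
have F0 : F 0 = 0.
  by have := FE (-1) 0 0; rewrite scaler0 addr0 mulN1r addNr.
rewrite -/(F (mxC B)) {1}[mxC B]matrix_sum_delta pair_big /=.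
apply: (big_rec2 (fun x y => F x = y)) => // q x y _ <-.
by rewrite FE; congr (_ * _ + _); rewrite !mxE.
Qed.

Variables (X : M -> R -> 'M[R]_N) (U : M -> R -> R -> MC).
Hypothesis XI : forall m i j, mu.-integrable setT (fun s => (X m s i j)%:E).
Variables (m0 : M) (f : M -> C) (s0 : R) (D : 'M[R]_N).
Hypothesis fE : forall phi k l, test_function phi ->
  pbdef P (fun m => smear X phi m k l) f /\
  P (fun m => smear X phi m k l) f m0 = (phi s0 * D k l)%:C%C.
Let W := to_pinfty (U m0).
Let V := from_minfty (U m0).
Hypotheses (WT : test_functionM W) (VT : test_functionM V).

(** The coefficient of the entry [q] of X(s) in entry (i, j) of T(+oo, s) (gamma R^{+-} X(s)) T(s,
    -oo), with both T frozen at [m0]. *)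
Let psi i j (q : 'I_N * 'I_N) s : C :=
  (gamma%:C)%C * (W s *m Rpm r e (delta_mx q.1 q.2) *m V s) i j.

Let psiT i j q : test_functionC (psi i j q).
Proof.
apply: test_functionC_mul; first exact: test_functionC_cst.
exact: (test_functionM_mul (test_functionM_mul WT (test_functionM_cst _)) VT i j).
Qed.

Let phi i j (p : bool * ('I_N * 'I_N)) s : R :=
  if p.1 then complex.Re (psi i j p.2 s) else complex.Im (psi i j p.2 s).

Let phiT i j p : test_function (phi i j p).
Proof. by case: p => [[] q]; have [] := psiT i j q. Qed.

(** The minus sign of the variation formula, with a factor i for the test functions that are
    imaginary parts. *)
Let coef (p : bool * ('I_N * 'I_N)) : C := if p.1 then -1 else - imC R.

Let variation_smear i j m :
  variation (connection r gamma X e) U m0 m i j =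
  \sum_p coef p * smear X (phi i j p) m p.2.1 p.2.2.
Proof.
have entryE s : (W s *m connection r gamma X e m s *m V s) i j =
    \sum_q (X m s q.1 q.2)%:C%C * psi i j q s.
  rewrite /connection -scalemxAr -scalemxAl mxE mulmx_Rpm_expand mulr_sumr.
  by apply: eq_bigr => q _; rewrite /psi mulrCA.
have int_sum (g : 'I_N * 'I_N -> R -> R) : (forall q, test_function (g q)) ->
    Rintegral mu setT (fun s => \sum_q X m s q.1 q.2 * g q s) =
    \sum_q Rintegral mu setT (fun s => g q s * X m s q.1 q.2).
  move=> gT.
  have gI q := integrable_test (gT q) (XI m q.1 q.2).
  rewrite -(Rintegral_sumf (index_enum _) gI).2.
  by apply: eq_Rintegral => s _; apply: eq_bigr => q _; rewrite mulrC.
have smearE b q : smear X (phi i j (b, q)) m q.1 q.2 =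
    (Rintegral mu setT (fun s => phi i j (b, q) s * X m s q.1 q.2))%:C%C.
  rewrite /smear !mxE; congr Complex; apply: eq_Rintegral => s _.
  by rewrite mxE.
have -> : variation (connection r gamma X e) U m0 m i j = - Complex
   (\sum_q Rintegral mu setT (fun s => phi i j (true, q) s * X m s q.1 q.2))
   (\sum_q Rintegral mu setT (fun s => phi i j (false, q) s * X m s q.1 q.2)).
  rewrite /variation /mx_integralC !mxE; congr (- Complex _ _).
    rewrite -int_sum => [|q]; last exact: (phiT i j (true, q)).
    apply: eq_Rintegral => s _; rewrite mxE entryE Re_sum.
    by apply: eq_bigr => q _; rewrite ReM /= mul0r subr0.
  rewrite -int_sum => [|q]; last exact: (phiT i j (false, q)).
  apply: eq_Rintegral => s _; rewrite mxE entryE Im_sum.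
  by apply: eq_bigr => q _; rewrite ImM /= mul0r addr0.
rewrite -(pair_bigA _ (fun b q => coef (b, q) * smear X (phi i j (b, q)) m q.1 q.2)).
have sumE b : \sum_q coef (b, q) * smear X (phi i j (b, q)) m q.1 q.2 =
    (if b then -1 else - imC R) *
    (\sum_q Rintegral mu setT (fun s => phi i j (b, q) s * X m s q.1 q.2))%:C%C.
  by rewrite rmorph_sum mulr_sumr; apply: eq_bigr => q _; rewrite smearE.
by rewrite big_bool !sumE; apply: complex_ext => /=; ring.
Qed.

Lemma pb_variation i j :
  P (fun m => variation (connection r gamma X e) U m0 m i j) f m0 =
  - ((gamma%:C)%C * (W s0 *m Rpm r e (mxC D) *m V s0) i j).
Proof.
have -> : (fun m => variation (connection r gamma X e) U m0 m i j) =
    fun m => \sum_p coef p * smear X (phi i j p) m p.2.1 p.2.2.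
  by apply/funext => m; exact: variation_smear.
(* Smearing with the zero function supplies the observable that [pb_sum] requires for the empty
   sum. *)
have [h0f _] := fE i j (test_function_cst 0).
have [|_ ->] := pb_sum h0f (index_enum _) coef
  (F := fun p m => smear X (phi i j p) m p.2.1 p.2.2).
  by move=> p; have [] := fE p.2.1 p.2.2 (phiT i j p).
under eq_bigr => p _ do rewrite (proj2 (fE p.2.1 p.2.2 (phiT i j p))).
rewrite mulmx_Rpm_expand mulr_sumr -sumrN.
rewrite -(pair_bigA _ (fun b q => coef (b, q) * (phi i j (b, q) s0 * D q.1 q.2)%:C%C)).
rewrite /= big_bool /= -big_split /=; apply: eq_bigr => q _.
rewrite mulrCA -/(psi i j q s0) /phi /coef /=.
by case: (psi i j q s0) => x y; apply: complex_ext => /=; ring.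
Qed.

End SmearedBrackets.

(** * The variation generated by the transfer matrices *)

Section Connection.
Variables (R : realType) (N : nat) (r : 'End('M[R]_N)) (gamma : R).

Lemma normC1_connection : exists2 K, 0 <= K & forall (M : Type) (X : M -> R -> 'M[R]_N) e m s,
  normC1 (connection r gamma X e m s) <= K * norm1 (X m s).
Proof.
(* X is real, so R^{+-} X has real part [r X], bounded by [K], and imaginary part plus or minus X,
   contributing the 1. *)
have [K K0 rK] := norm1_lfun r; exists (`|gamma| * (K + 1)) => [|M X e m s].
  by rewrite mulr_ge0 // addr_ge0.
have norm1Z c (A : 'M[R]_N) : norm1 (c *: A) = `|c| * norm1 A.
  rewrite /norm1 mulr_sumr; apply: eq_bigr => i _; rewrite mulr_sumr.
  by apply: eq_bigr => j _; rewrite mxE normrM.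
rewrite /connection /normC1 mxReZ mxImZ /= !scale0r subr0 addr0 !norm1Z -mulrDr -mulrA.
apply: ler_wpM2l => //; rewrite /Rpm mxReD mxImD mxReZ mxImZ !mxCK.
have -> : complex.Re (if e then imC R else - imC R) = 0 by case: e; rewrite //= oppr0.
rewrite [r 0]linear0 !(scale0r, scaler0) subr0 !addr0 !add0r norm1Z.
have -> : `|complex.Im (if e then imC R else - imC R)| = 1.
  by case: e; rewrite /= ?normrN normr1.
by rewrite mul1r mulrDl mul1r lerD2r.
Qed.

(** Turns continuity and integrability of X into the pair [alpha], [Phi] assumed throughout the
    theory of path-ordered exponentials. *)
Lemma connection_bound (G : set 'M[R]_N) (L : {vspace 'M[R]_N}) (M : Type)
    (g X : M -> R -> 'M[R]_N) e m :
  admissible_fields G L (g m) (X m) ->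
  exists alpha Phi : R -> R,
    [/\ forall s, 0 <= alpha s,
        forall s, normC1 (connection r gamma X e m s) <= alpha s,
        forall s, is_derive s (1 : R) Phi (alpha s) &
        exists B, forall s, `|Phi s| <= B].
Proof.
case=> _ _ _ Xc Xint; have [K K0 hK] := normC1_connection.
pose alpha s := \sum_(p : 'I_N * 'I_N) K * `|X m s p.1 p.2|.
have alphaE s : alpha s = K * norm1 (X m s).
  by rewrite /alpha -mulr_sumr /norm1 pair_big.
have alpha0 s : 0 <= alpha s by rewrite alphaE mulr_ge0 ?norm1_ge0.
have [||Phi [B [dPhi PB]]] := @bounded_primitive R alpha _ alpha0.
- apply: continuous_sumf => p; apply: continuous_mulf; first exact: cst_continuous.
  by move=> s; apply: cvg_norm; exact: Xc.
- have [|h _] := Rintegral_sumf (index_enum _)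
      (F := fun (p : 'I_N * 'I_N) s => K * `|X m s p.1 p.2|); last exact: h.
  move=> p; apply: integrable_test; first exact: test_function_cst.
  by have [_ _ XI] := Xint p.1 p.2; apply: (integrable_norm XI).
exists alpha, Phi; split=> // [s|]; first by rewrite alphaE.
by exists B.
Qed.

End Connection.

Section Variation.
Variables (R : realType) (N : nat) (L : {vspace 'M[R]_N}) (G : set 'M[R]_N).
Variables (r : 'End('M[R]_N)) (gamma : R) (n : nat) (a b : 'I_n -> 'M[R]_N).
Variables (M : Type) (P : poisson_bracket R M) (g X : M -> R -> 'M[R]_N).
Variable T : bool -> M -> R -> R -> 'M[R[i]]_N.
Hypotheses (hL : lie_subalgebra L) (rL : endo_on L r) (rskew : killing_skew L r).
Hypothesis gamma0 : gamma != 0.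
Hypothesis Cab : casimir_decomposition L a b.
Hypothesis gX : forall m, admissible_fields G L (g m) (X m).
Hypothesis TE : forall e m, path_ordered_exp (connection r gamma X e m) (T e m).
Hypothesis TP : forall e, pb_by_variation P X (connection r gamma X e) (T e).
Variables (eps : 'M[R]_N) (s : R) (m : M).
Hypothesis epsL : eps \in L.

Local Notation V e := (from_minfty (T e m) s).
Local Notation Ad e := (V e *m mxC eps *m invmx (V e)).

Let connection_mem e u : memC L (connection r gamma X e m u).
Proof.
apply: memCZ; apply: memC_Rpm => //; apply: memC_mxC.
by have [_ XL _ _ _] := gX m; exact: XL.
Qed.

Lemma left_log_pbE e (f : M -> R[i]) (D : 'M[R]_N) :
  (forall phi k l, test_function phi ->
     pbdef P (fun m => smear X phi m k l) f /\
     P (fun m => smear X phi m k l) f m = (phi s * D k l)%:C%C) ->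
  left_log_pb P (fun m' => whole_line (T e m')) f m =
  - (gamma%:C)%C *: (invmx (V e) *m Rpm r e (mxC D) *m V e).
Proof.
move=> fE; have [alpha [Phi [alpha0 A_le dPhi PhiB]]] := connection_bound r gamma e (gX m).
have [Vu whole_to VT WT] := path_exp_minfty (TE e m) alpha0 A_le dPhi PhiB s.
have XI m' i j : (@lebesgue_measure R).-integrable setT (fun s => (X m' s i j)%:E).
  by have [_ _ _ _ /(_ i j)[]] := gX m'.
have fdef phi : test_function phi -> forall i j, pbdef P (fun m => smear X phi m i j) f.
  by move=> phiT i j; have [] := fE phi i j phiT.
rewrite /left_log_pb.
have -> : (\matrix_(i, j) P (fun m' => whole_line (T e m') i j) f m) =
    - (gamma%:C)%C *: (to_pinfty (T e m) s *m Rpm r e (mxC D) *m V e).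
  apply/matrixP => i j; rewrite !mxE; have [_ ->] := TP e fdef i j.
  by rewrite (pb_variation r gamma e XI fE WT VT) !mxE mulNr.
by rewrite -scalemxAr !mulmxA whole_to.
Qed.

Lemma memC_Ad e : memC L (Ad e).
Proof.
have [alpha [Phi [alpha0 A_le dPhi PhiB]]] := connection_bound r gamma e (gX m).
by have [] := from_minfty_Ad (TE e m) alpha0 A_le dPhi PhiB hL (connection_mem e) s
  (memC_mxC epsL).
Qed.

Lemma memC_Ad_inv e Z : memC L Z -> memC L (invmx (V e) *m Z *m V e).
Proof.
have [alpha [Phi [alpha0 A_le dPhi PhiB]]] := connection_bound r gamma e (gX m).
by case/(from_minfty_Ad (TE e m) alpha0 A_le dPhi PhiB hL (connection_mem e) s).
Qed.

(** Invariance of the Killing form moves the conjugation onto [eps]; transposing R^{+-} then flips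
    its sign label. This is why K combines R^+ with T(lambda_-) and R^- with T(lambda_+). *)
Lemma killingC_Ad_Rpm e Z : memC L Z ->
  killingC L (mxC eps) (invmx (V e) *m Rpm r e Z *m V e) =
  - killingC L (Rpm r (~~ e) (Ad e)) Z.
Proof.
move=> ZL; have [alpha [Phi [alpha0 A_le dPhi PhiB]]] := connection_bound r gamma e (gX m).
have [Vu _ _ _] := path_exp_minfty (TE e m) alpha0 A_le dPhi PhiB s.
have AdL := from_minfty_Ad (TE e m) alpha0 A_le dPhi PhiB hL (connection_mem e) s.
rewrite -(killingC_Ad hL (mulmxV Vu) (mulVmx Vu)) //.
- by rewrite (Rpm_skew hL rL (~~ e) rskew (memC_Ad e) ZL) negbK opprK.
- by move=> Y YL; have [] := AdL Y YL.
- by move=> Y YL; have [] := AdL Y YL.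
- exact: memC_mxC.
- exact: memC_Rpm.
Qed.

Lemma memC_Kfield : memC L (Kfield r T eps s m).
Proof. by apply: memCB; apply: memCZ; apply: memC_Rpm => //; apply: memC_Ad. Qed.

(** Meant for [f] a single matrix entry of g(s) or X(s): the second factor of the Casimir then
    contributes scalars [h t], and D is the combination of the [a t] with these weights. The sum
    over [t] is kept so that it can be contracted with K afterwards. *)
Lemma delta_epsE (f : M -> R[i]) (h : 'I_n -> R) :
  (forall phi k l, test_function phi ->
     pbdef P (fun m => smear X phi m k l) f /\
     P (fun m => smear X phi m k l) f m =
       (phi s * (\sum_t a t k l * h t))%:C%C) ->
  delta_eps P L gamma T eps f m =
  \sum_t killingC L (Kfield r T eps s m) (mxC (a t)) * (h t)%:C%C.
Proof.
move=> fE; case: (Cab) => aL bL _; pose D := \sum_t h t *: a t.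
have DE k l : \sum_t a t k l * h t = D k l.
  by rewrite summxE; apply: eq_bigr => t _; rewrite mxE mulrC.
have DL : memC L (mxC D).
  by apply: memC_mxC; apply: memv_suml => t _; rewrite memvZ.
have fD phi k l : test_function phi ->
    pbdef P (fun m => smear X phi m k l) f /\
    P (fun m => smear X phi m k l) f m = (phi s * D k l)%:C%C.
  by rewrite -DE; exact: fE.
have -> : \sum_t killingC L (Kfield r T eps s m) (mxC (a t)) * (h t)%:C%C =
    killingC L (Kfield r T eps s m) (mxC D).
  have -> : mxC D = \sum_t (h t)%:C%C *: mxC (a t).
    rewrite mxCE map_mx_sum; apply: eq_bigr => t _.
    by rewrite map_mxZ mxCE.
  suff [] : memC L (\sum_t (h t)%:C%C *: mxC (a t)) /\
    \sum_t killingC L (Kfield r T eps s m) (mxC (a t)) * (h t)%:C%C =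
    killingC L (Kfield r T eps s m) (\sum_t (h t)%:C%C *: mxC (a t)) by [].
  apply: (big_rec2 (fun x y => memC L x /\ y = killingC L _ x)) => [|t x y _ [xL ->]].
    by split; [exact: memC0 | rewrite killingC0r].
  have atL := memC_mxC (aL t).
  by split; [apply: memCD => //; apply: memCZ | rewrite killingC_linearr // mulrC].
rewrite /delta_eps !(left_log_pbE _ fD).
have AL e : memC L (invmx (V e) *m Rpm r e (mxC D) *m V e).
  by apply: memC_Ad_inv; apply: memC_Rpm.
have g0 : (gamma%:C)%C != 0 by rewrite fmorph_eq0.
have i0 : imC R != 0 by rewrite eq_complex /= oner_eq0 andbF.
rewrite [in X in _ - X]scaleNr opprK killingC_linearr //; last exact: memCZ.
rewrite (killingC_scaler hL _ _ (AL _)).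
have RL e e' : memC L (Rpm r e (Ad e')) by apply: memC_Rpm => //; apply: memC_Ad.
rewrite !killingC_Ad_Rpm // (killingC_sym hL memC_Kfield DL) /Kfield -scaleNr.
rewrite killingC_linearr //; last exact: memCZ.
rewrite (killingC_scaler hL _ _ (RL _ _)) -!(killingC_sym hL (RL _ _) DL) /=.
(* What remains is scalar: [gamma] from the connection cancels the one in the prefactor, and the
   minus signs of the prefactor, the variation formula and the transposition combine to those of
   K. *)
move: (killingC L _ _) (killingC L _ _) => x y.
by field; rewrite g0 i0.
Qed.

End Variation.

Theorem mainTheorem4 (R : realType) (N : nat)
  (L : {vspace 'M[R]_N}) (G : set 'M[R]_N) (r : 'End('M[R]_N)) (gamma : R)
  (n : nat) (a b : 'I_n -> 'M[R]_N)
  (M : Type) (P : poisson_bracket R M) (g X : M -> R -> 'M[R]_N)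
  (T : bool -> M -> R -> R -> 'M[R[i]]_N) :
  lie_subalgebra L -> lie_semisimple L ->
  matrix_group_with_lie_algebra G L ->
  endo_on L r -> killing_skew L r -> mCYBE_nonsplit L r ->
  gamma != 0 ->
  casimir_decomposition L a b ->
  (forall m, admissible_fields G L (g m) (X m)) ->
  (forall s s', pb12_def P (at_pt g s) (at_pt g s') /\
     forall m, pb12 P (at_pt g s) (at_pt g s') m = 0) ->
  pb12_delta P X g (fun m s => (1%:M *t g m s) *m casimir a b) ->
  pb12_delta P X X (fun m s => - lie (casimir a b) (1%:M *t X m s)) ->
  (forall e m, path_ordered_exp (connection r gamma X e m) (T e m)) ->
  (forall e, pb_by_variation P X (connection r gamma X e) (T e)) ->
  forall (eps : 'M[R]_N), eps \in L ->
  forall (s : R) (m : M),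
    delta_eps_mx P L gamma T eps (at_pt g s) m =
      at_pt g s m *m Kfield r T eps s m /\
    delta_eps_mx P L gamma T eps (at_pt X s) m =
      lie (at_pt X s m) (Kfield r T eps s m).
Proof.
move=> hL _ _ rL rskew _ gamma0 Cab gX _ PXg PXX TE TP eps epsL s m.
(* The delta hypotheses are integrals against a Dirac measure; continuity in the point makes the
   integrands measurable, so that they are evaluated at [s]. *)
have gc m' i j : continuous (fun u => g m' u i j) by have [_ _ h _ _] := gX m'; exact: h.
have Xc m' i j : continuous (fun u => X m' u i j) by have [_ _ _ h _] := gX m'; exact: h.
have mul_cont (F : R -> 'M[R]_N) B p q : (forall i j, continuous (fun u => F u i j)) ->
    continuous (fun u => (F u *m B) p q).
  move=> Fc; under eq_fun do rewrite mxE; apply: continuous_sumf => k.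
  by apply: continuous_mulf => //; exact: cst_continuous.
have mulr_cont (F : R -> 'M[R]_N) B p q : (forall i j, continuous (fun u => F u i j)) ->
    continuous (fun u => (B *m F u) p q).
  move=> Fc; under eq_fun do rewrite mxE; apply: continuous_sumf => k.
  by apply: continuous_mulf => //; exact: cst_continuous.
(* Here g meets only the second tensor factor, so each entry is an entry of [a t] times one of
   [g b t]; the latter is the weight [h t]. *)
have gDE m' u i j : ((1%:M *t g m' u) *m casimir a b) i j =
    \sum_t a t (mxtens_unindex i).1 (mxtens_unindex j).1 *
      (g m' u *m b t) (mxtens_unindex i).2 (mxtens_unindex j).2.
  rewrite /casimir mulmx_sumr summxE; apply: eq_bigr => t _.
  by rewrite tensmx_mul mul1mx mxE.
(* The sign is absorbed by reversing the commutator: - [C_12, X_2] is the sum of the [a t] tensored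
   with [X, b t]. *)
have XDE m' u i j : (- lie (casimir a b) (1%:M *t X m' u)) i j =
    \sum_t a t (mxtens_unindex i).1 (mxtens_unindex j).1 *
      (lie (X m' u) (b t)) (mxtens_unindex i).2 (mxtens_unindex j).2.
  rewrite /lie opprB /casimir mulmx_sumr mulmx_suml -sumrB summxE.
  apply: eq_bigr => t _; rewrite !tensmx_mul mul1mx mulmx1.
  by rewrite ![in LHS]mxE ![in RHS]mxE mulrBr.
have gDc m' i j : continuous (fun u => ((1%:M *t g m' u) *m casimir a b) i j).
  under eq_fun do rewrite gDE; apply: continuous_sumf => t.
  by apply: continuous_mulf; [exact: cst_continuous | exact: mul_cont].
have XDc m' i j : continuous (fun u => (- lie (casimir a b) (1%:M *t X m' u)) i j).
  under eq_fun do rewrite XDE; apply: continuous_sumf => t.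
  apply: continuous_mulf; first exact: cst_continuous.
  under eq_fun do rewrite /lie mxE [X in _ + X]mxE.
  by apply: continuous_subf; [exact: mul_cont | exact: mulr_cont].
have KL := memC_Kfield hL rL gX TE s m epsL.
set K := Kfield r T eps s m in KL *.
split; apply/matrixP => p q; rewrite mxE.
  rewrite (delta_epsE hL rL rskew gamma0 Cab gX TE TP epsL
    (s := s) (h := fun t => (g m s *m b t) p q)) => [|phi k l phiT].
    (* K is replaced by its Casimir expansion over the [b t], which matches the sum delivered by
       [delta_epsE] term by term. *)
    rewrite -[in RHS](casimirC_flip hL Cab KL) mulmx_sumr summxE.
    apply: eq_bigr => t _; rewrite -scalemxAr [RHS]mxE; congr (_ * _).
    by rewrite /at_pt !mxCE -map_mxM [RHS]mxE.
  have [h1 h2] := pb12_delta_entry PXg gDc s k l p q phiT.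
  by split=> //; rewrite h2 gDE !mxtens_indexK.
rewrite (delta_epsE hL rL rskew gamma0 Cab gX TE TP epsL
  (s := s) (h := fun t => lie (X m s) (b t) p q)) => [|phi k l phiT].
  rewrite -[in RHS](casimirC_flip hL Cab KL) /lie mulmx_sumr mulmx_suml -sumrB summxE.
  apply: eq_bigr => t _; rewrite -scalemxAr -scalemxAl -scalerBr [RHS]mxE; congr (_ * _).
  by rewrite /at_pt !mxCE -!map_mxM -map_mxB [RHS]mxE.
have [h1 h2] := pb12_delta_entry PXX XDc s k l p q phiT.
by split=> //; rewrite h2 XDE !mxtens_indexK.
Qed.
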